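(* Let $H$ be a real or complex separable infinite-dimensional Hilbert space, with scalar field $\mathbb{K}=\mathbb{R}$ or $\mathbb{C}$. There exists a bounded linear operator $T$ on $H$ which is hypercyclic and such that for every vector $x\in H$ the closure of the orbit $\mathcal{O}rb(x,T)$ is a (linear) subspace of $H$; i.e. for every $x\in H$ the closures of the two sets $\{T^{n}x : n\geq 0\}$ and $\{p(T)x : p\in\mathbb{K}[\zeta]\}$ coincide.
   Context: For a bounded operator $T$ on $H$ and $x\in H$, $\mathcal{O}rb(x,T)=\{T^{n}x : n\geq 0\}$. A vector $x$ is hypercyclic for $T$ if $\mathcal{O}rb(x,T)$ is dense in $H$, and $T$ is hypercyclic if it admits a hypercyclic vector. $\mathbb{K}[\zeta]$ is the space of polynomials with coefficients in $\mathbb{K}$. *)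

(* Defs.v *)
From HB Require Import structures.
From mathcomp Require Import all_boot all_order all_algebra.
From mathcomp Require Import complex.
From mathcomp Require Import all_classical all_reals all_analysis.

Set Implicit Arguments.
Unset Strict Implicit.
Unset Printing Implicit Defensive.

Import Order.TTheory GRing.Theory Num.Theory.
Import numFieldNormedType.Exports.

Local Open Scope classical_set_scope.
Local Open Scope ring_scope.

(* For [K = R[i]] the norms [`|x|] and [`|a|] take values in [K]; the order of
   [K] makes them real and nonnegative. *)

(* The norm of [H] comes from the inner product [dot], which is linear in its
   first argument and [theta]-linear in its second.  A complete [H] with such
   a [dot] is a Hilbert space. *)
Definition norm_from_dot (K : numFieldType) (H : normedModType K)
    (theta : K -> K) (dot : {dot H for theta}) : Prop :=
  forall x : H, `|x| ^+ 2 = dot x x.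

Definition separable (X : topologicalType) : Prop :=
  exists2 D : set X, countable D & dense D.

(* Dimension is algebraic: no finite family spans [V]. *)
Definition infinite_dimensional (K : fieldType) (V : lmodType K) : Prop :=
  forall (n : nat) (e : 'I_n -> V),
    exists x : V, forall c : 'I_n -> K, x <> \sum_(i < n) c i *: e i.

Section Orbits.
Variables (K : numFieldType) (H : normedModType K).

Definition bounded_operator (T : {linear H -> H}) : Prop :=
  exists M : K, forall x : H, `|T x| <= M * `|x|.

Definition Orb (x : H) (T : H -> H) : set H :=
  [set iter n T x | n in [set: nat]].

Definition poly_op (p : {poly K}) (T : H -> H) (x : H) : H :=
  \sum_(i < size p) p`_i *: iter i T x.

Definition poly_Orb (x : H) (T : H -> H) : set H :=
  [set poly_op p T x | p in [set: {poly K}]].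

Definition hypercyclic_vector (x : H) (T : H -> H) : Prop := dense (Orb x T).

Definition hypercyclic (T : H -> H) : Prop :=
  exists x : H, hypercyclic_vector x T.

Definition linear_subspace (A : set H) : Prop := GRing.submod_closed (mem A).

End Orbits.

(* Main.v *)
Require Import Defs.
From HB Require Import structures.
From mathcomp Require Import all_boot all_order all_algebra.
From mathcomp Require Import complex.
From mathcomp Require Import all_classical all_reals all_analysis.
From mathcomp Require Import ring zify.

Set Implicit Arguments.
Unset Strict Implicit.
Unset Printing Implicit Defensive.

Import Order.TTheory GRing.Theory Num.Theory.
Import numFieldNormedType.Exports.

Local Open Scope classical_set_scope.
Local Open Scope ring_scope.
Local Open Scope complex_scope.

(** The theorem follows from the existence of a bounded operator [T] with a
cyclic vector [e 0] such that, for each [q] in a dense set of polynomials,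
some powers of [T] converge pointwise to [q(T)]: then [p(T)x] lies in the
closure of the orbit of [x] for all [p] and [x], so this closure is that of
[{p(T)x}] ([orbit_closure_subspace]), and for [x = e 0] it is everything.
Quantitatively, [power_near_polynomial] produces arbitrarily large [n] with
[|T^n x - q(T)x| <= eps |x| + C(q) |x - P_n x|], where [P_n] is the projection
on the first [n] basis vectors and [C(q)] does not depend on [n].

Why such an [n] can exist: multiplication by [X] on [K[X]/(X^n - q)] satisfies
[A^n = q(A)] exactly.  In a basis of multiples of [1, X, X^2, ...] it is a
weighted shift, except that the last vector [X^(n-1)/b] is sent to [q/b].  If
the weights are a constant [om > 1], arbitrarily close to [1], then [b] grows
exponentially with [n] and this last column becomes as small as wanted.  On the
other basis vectors let the operator be a weighted shift with weights at most
[om'], where [om' ^ n] is bounded in terms of [q] alone; there the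
difference of its [n]-th power and its image under [q] is bounded by some
[C(q)].  Both facts survive
perturbations of the operator that are small enough in terms of [n], and all
that is built after [n] is such a perturbation ([cut_operator],
[iter_near_poly]).

Going on to the next polynomial requires returning from [X^n - q] to a pure
power of [X].  This is done slowly: after [n] the basis vectors are multiples
of [X^i (X^n - t q)], with [t] decreasing from [1] to [0] in [M] steps.  Each of
these [M] columns departs from a weighted shift by [O(1/M)], so the sum of the
squares of the departures, which bounds the square of the operator norm, is
[O(1/M)] as well ([norm_error_fade]).  The estimate needs [|X^i| <= C om' ^ i],
which holds because [om' ^ n] exceeds the coefficient sum of [q] sufficiently
([orbit_vec_growth]).  Such blocks, one for each polynomial, are added one after
the other ([next_block_exists]); all smallness requirements are collected in a
budget for the sum of the squared column errors.

The scalar field is any archimedean [numFieldType] with a dense sequence, so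
that the real and the complex case are the same proof. *)

(** * Orthonormal bases *)

(** The four properties of a Hilbert basis that the construction uses, with [c]
the coordinate functionals; the inner product itself is not among them. *)
Record orthonormal_basis (K : numFieldType) (H : normedModType K)
    (e : nat -> H) (c : nat -> {scalar H}) : Prop := OrthonormalBasis {
  coord_basis : forall i j, c i (e j) = (i == j)%:R;
  sqr_norm_comb : forall l m (a : nat -> K),
    `|\sum_(l <= j < m) a j *: e j| ^+ 2 = \sum_(l <= j < m) `|a j| ^+ 2;
  bessel : forall m x, \sum_(0 <= j < m) `|c j x| ^+ 2 <= `|x| ^+ 2;
  expansion : forall x eps, 0 < eps -> exists m0, forall m, (m0 <= m)%N ->
    `|x - \sum_(0 <= j < m) c j x *: e j| < eps }.

Lemma norm_le_of_sqr (K : numFieldType) (H : normedModType K) (x : H) (r : K) :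
  0 <= r -> `|x| ^+ 2 <= r ^+ 2 -> `|x| <= r.
Proof. by move=> r0; rewrite ler_sqr ?nnegrE. Qed.

(** Stated without square roots, which an arbitrary [numFieldType] does not
have.  The induction step is the inequality
[4 (x^2 B) (A y^2) <= (x^2 B + A y^2)^2]. *)
Lemma cauchy_schwarz_nat (K : numFieldType) (l m : nat) (a b : nat -> K) :
  (forall j, 0 <= a j) -> (forall j, 0 <= b j) ->
  (\sum_(l <= j < m) a j * b j) ^+ 2 <=
  (\sum_(l <= j < m) a j ^+ 2) * (\sum_(l <= j < m) b j ^+ 2).
Proof.
move=> a0 b0; have [ml|lm] := leqP m l.
  by rewrite !big_geq // expr0n mulr0.
rewrite -(subnKC (ltnW lm)); elim: (m - l)%N => [|k IH].
  by rewrite addn0 !big_geq // expr0n mulr0.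
rewrite addnS !big_nat_recr ?leq_addr //=.
set S := \sum_(_ <= _ < _) _ in IH *; set A := \sum_(_ <= _ < _) _ in IH *.
set B := \sum_(_ <= _ < _) _ in IH *; set x := a _; set y := b _.
have x0 : 0 <= x by exact: a0.
have y0 : 0 <= y by exact: b0.
have S0 : 0 <= S by apply: sumr_ge0 => i _; rewrite mulr_ge0.
have A0 : 0 <= A by apply: sumr_ge0 => i _; rewrite exprn_ge0.
have B0 : 0 <= B by apply: sumr_ge0 => i _; rewrite exprn_ge0.
have -> : (A + x ^+ 2) * (B + y ^+ 2)
   = A * B + (x ^+ 2 * B + A * y ^+ 2) + (x * y) ^+ 2 by ring.
rewrite sqrrD lerD2r lerD //.
have -> : S * (x * y) *+ 2 = S * (x * y) * 2 by rewrite mulr_natr.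
rewrite -ler_sqr ?nnegrE ?addr_ge0 ?mulr_ge0 ?exprn_ge0 //.
apply: (@le_trans _ _ (A * B * (x * y) ^+ 2 * 4)).
  rewrite !exprMn -[2 ^+ 2]natrX ler_wpM2r // -!exprMn.
  by rewrite exprMn ler_wpM2r // exprn_ge0 // mulr_ge0.
rewrite -subr_ge0.
have -> : (x ^+ 2 * B + A * y ^+ 2) ^+ 2 - A * B * (x * y) ^+ 2 * 4
   = (x ^+ 2 * B - A * y ^+ 2) ^+ 2 by ring.
by rewrite real_exprn_even_ge0 // rpredB // ger0_real // ?mulr_ge0 // exprn_ge0.
Qed.

Section Basis.
Variables (K : numFieldType) (H : completeNormedModType K).
Variables (e : nat -> H) (c : nat -> {scalar H}).
Hypothesis onb : orthonormal_basis e c.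

Definition trunc (m : nat) (x : H) : H := \sum_(0 <= j < m) c j x *: e j.

Lemma trunc_cvg x : trunc ^~ x @ \oo --> x.
Proof.
apply/cvgrPdist_lt => eps eps0; have [m0 Hm] := expansion onb x eps0.
by exists m0 => // m /= /Hm.
Qed.

Lemma norm_basis j : `|e j| = 1.
Proof.
have := sqr_norm_comb onb j j.+1 (fun=> 1).
rewrite !big_nat1 scale1r normr1 expr1n => /eqP.
by rewrite sqrp_eq1 // => /eqP.
Qed.

Lemma norm_coord j x : `|c j x| <= `|x|.
Proof.
rewrite -ler_sqr ?nnegrE //; apply: le_trans (bessel onb j.+1 x).
by rewrite big_nat_recr //= lerDr sumr_ge0 // => i _; rewrite exprn_ge0.
Qed.

Lemma norm_trunc m x : `|trunc m x| <= `|x|.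
Proof.
by apply: norm_le_of_sqr => //; rewrite (sqr_norm_comb onb); exact: (bessel onb).
Qed.

Lemma truncB l m x : (l <= m)%N ->
  trunc m x - trunc l x = \sum_(l <= j < m) c j x *: e j.
Proof.
by move=> lm; rewrite /trunc (@big_cat_nat _ _ _ l 0 m) //= [LHS]addrC addKr.
Qed.

Lemma coord_trunc m i x : c i (trunc m x) = if (i < m)%N then c i x else 0.
Proof.
rewrite /trunc linear_sum /=.
under eq_bigr do rewrite linearZ /= (coord_basis onb).
case: ltnP => im; last first.
  rewrite big_nat_cond big1 // => j /andP[/andP[_ jm] _].
  by rewrite gtn_eqF ?mulr0 // (leq_trans jm).
rewrite (@big_cat_nat _ _ _ i 0 m) ?(ltnW im) //=.
rewrite [X in _ + X]big_ltn //= eqxx mulr1.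
rewrite big_nat_cond big1 ?add0r => [|j /andP[/andP[_ ji] _]]; last first.
  by rewrite gtn_eqF ?mulr0.
rewrite big_nat_cond big1 ?addr0 // => j /andP[/andP[ij _] _].
by rewrite ltn_eqF ?mulr0.
Qed.

Lemma norm_lim_le (y : nat -> H) (l : H) (b : K) :
  y @ \oo --> l -> (forall m, `|y m| <= b) -> `|l| <= b.
Proof.
move=> /cvgrPdist_lt yl yb; apply/ler_addgt0Pr => eps eps0.
have [m0 _ /(_ m0 (leqnn _)) Hm] := yl _ eps0.
rewrite -(subrK (y m0) l) addrC (le_trans (ler_normD _ _)) // lerD //.
exact: ltW.
Qed.

Lemma bounded_cvg (L : {linear H -> H}) (B : K) (y : nat -> H) (x : H) :
  (forall z, `|L z| <= B * `|z|) -> y @ \oo --> x ->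
  (fun n => L (y n)) @ \oo --> L x.
Proof.
move=> LB /cvgrPdist_lt yx; apply/cvgrPdist_lt => eps eps0.
have B0 : 0 <= B.
  by have := le_trans (normr_ge0 _) (LB (e 0)); rewrite norm_basis mulr1.
have B1 : 0 < B + 1 by rewrite ltr_wpDl.
have [m0 _ Hm] := yx _ (divr_gt0 eps0 B1).
exists m0 => // m /= /Hm /=; rewrite -linearB ltr_pdivlMr // => /le_lt_trans-> //.
by rewrite (le_trans (LB _)) // mulrC ler_wpM2l // lerDl.
Qed.

Lemma bounded_le_trunc (L : {linear H -> H}) (B b : K) (x : H) :
  (forall z, `|L z| <= B * `|z|) -> (forall m, `|L (trunc m x)| <= b) ->
  `|L x| <= b.
Proof.
by move=> LB Lb; exact: norm_lim_le (bounded_cvg LB (@trunc_cvg x)) Lb.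
Qed.

(** A weighted shift sends an orthonormal family to multiples of another one,
so its norm is at most the supremum of the weights. *)
Lemma norm_shift_comb (w : nat -> K) (B t : K) l m (a : nat -> K) :
  0 <= B -> 0 <= t -> (forall j, (l <= j < m)%N -> `|w j| <= B) ->
  \sum_(l <= j < m) `|a j| ^+ 2 <= t ^+ 2 ->
  `|\sum_(l <= j < m) a j *: (w j *: e j.+1)| <= B * t.
Proof.
move=> B0 t0 wB at2; apply: norm_le_of_sqr; first exact: mulr_ge0.
under eq_bigr do rewrite scalerA.
rewrite -(big_add1 _ _ l m.+1 xpredT (fun j => (a j.-1 * w j.-1) *: e j)) /=.
rewrite (sqr_norm_comb onb) big_add1 /= exprMn.
apply: (@le_trans _ _ (B ^+ 2 * \sum_(l <= j < m) `|a j| ^+ 2)); last first.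
  by rewrite ler_wpM2l // exprn_ge0.
rewrite mulr_sumr; apply: ler_sum_nat => j lj.
rewrite normrM exprMn mulrC ler_wpM2r ?exprn_ge0 // ler_sqr ?nnegrE //.
exact: wB.
Qed.

(** The Hilbert-Schmidt bound, by Cauchy-Schwarz. *)
Lemma norm_columns_comb (v : nat -> H) (s t : K) l m (a : nat -> K) :
  0 <= s -> 0 <= t -> \sum_(l <= j < m) `|v j| ^+ 2 <= s ^+ 2 ->
  \sum_(l <= j < m) `|a j| ^+ 2 <= t ^+ 2 ->
  `|\sum_(l <= j < m) a j *: v j| <= s * t.
Proof.
move=> s0 t0 vs at2; apply: (le_trans (ler_norm_sum _ _ _)).
under eq_bigr do rewrite normrZ.
have S0 : 0 <= \sum_(l <= j < m) `|a j| * `|v j|.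
  by apply: sumr_ge0 => j _; rewrite mulr_ge0.
rewrite -ler_sqr ?nnegrE ?mulr_ge0 //.
apply: le_trans (cauchy_schwarz_nat _ _ _ _) _ => //.
by rewrite exprMn mulrC ler_pM // sumr_ge0 // => j _; rewrite exprn_ge0.
Qed.

End Basis.

(** * Operators given by their columns *)

Section ColumnOperator.
Variables (K : numFieldType) (H : completeNormedModType K).
Variables (e : nat -> H) (c : nat -> {scalar H}).
Hypothesis onb : orthonormal_basis e c.
Variables (w : nat -> K) (v : nat -> H) (B s : K).
Hypotheses (B0 : 0 <= B) (s0 : 0 <= s) (wB : forall j, `|w j| <= B).
Hypothesis vs : forall m, \sum_(0 <= j < m) `|v j| ^+ 2 <= s ^+ 2.

Let partial (m : nat) (x : H) : H :=
  \sum_(0 <= j < m) c j x *: (w j *: e j.+1 + v j).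

Lemma partialB_le l m x t : (l <= m)%N -> 0 <= t ->
  \sum_(l <= j < m) `|c j x| ^+ 2 <= t ^+ 2 ->
  `|partial m x - partial l x| <= (B + s) * t.
Proof.
move=> lm t0 ct; rewrite /partial (@big_cat_nat _ _ _ l 0 m) //= [X in `|X|]addrC.
rewrite addKr; under eq_bigr do rewrite scalerDr.
rewrite big_split /= mulrDl (le_trans (ler_normD _ _)) // lerD //.
  by apply: (norm_shift_comb onb).
apply: norm_columns_comb => //; apply: le_trans (vs m).
rewrite [leRHS](@big_cat_nat _ _ _ l 0 m) //= lerDr.
by rewrite sumr_ge0 // => j _; rewrite exprn_ge0.
Qed.

Lemma partial_cvg x : cvgn (partial ^~ x).
Proof.
apply/cauchy_cvgP/cauchy_exP => eps eps0.
have B1 : 0 < (B + s + 1) * 2 by rewrite mulr_gt0 // ltr_wpDl // addr_ge0.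
have d0 := divr_gt0 eps0 B1.
have [m0 Hm] := expansion onb x d0; exists (partial m0 x).
exists m0 => // m /= m0m; rewrite -ball_normE /= distrC.
set d := eps / _ in d0 Hm.
have dE : eps = d * ((B + s + 1) * 2) by rewrite /d divfK // gt_eqF.
apply: (@le_lt_trans _ _ ((B + s) * (d * 2))); last first.
  by rewrite dE mulrCA ltr_pM2l // ltr_pM2r // ltrDl.
have d2 : 0 <= d * 2 by rewrite mulr_ge0 // ltW.
apply: partialB_le => //.
rewrite -(sqr_norm_comb onb) -truncB // ler_sqr ?nnegrE //.
rewrite -[trunc e c m x](subrK x) -addrA mulr_natr mulr2n.
rewrite (le_trans (ler_normD _ _)) // distrC lerD // ltW //; exact: Hm.
Qed.

(** A weighted shift plus a Hilbert-Schmidt perturbation extends from the basis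
to a bounded operator.  The partial sums are Cauchy because those of [x] are. *)
Lemma column_operator : exists T : {linear H -> H},
  (forall j, T (e j) = w j *: e j.+1 + v j) /\
  (forall x, `|T x| <= (B + s) * `|x|).
Proof.
pose f x := limn (partial ^~ x).
have f_cvg x : partial ^~ x @ \oo --> f x by exact: partial_cvg.
have f_lin : linear f.
  move=> a x y; apply: norm_cvg_lim.
  have -> : partial ^~ (a *: x + y) = a *: (partial ^~ x) + partial ^~ y.
    apply/funext => m.
    rewrite -[RHS]/(a *: partial m x + partial m y) /partial scaler_sumr -big_split /=.
    by apply: eq_bigr => j _; rewrite linearP scalerDl scalerA.
  by apply: cvgD (f_cvg y); apply: cvgZl_tmp (f_cvg x).
pose T : {linear H -> H} :=
  HB.pack f (GRing.isLinear.Build K H H _ f f_lin).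
exists T; split => [j|x] /=.
  apply: norm_cvg_lim; apply: cvg_near_cst; exists j.+1 => // m /= jm.
  rewrite /partial (@big_cat_nat _ _ _ j.+1 0 m) //= big_nat_recr //=.
  rewrite (coord_basis onb) eqxx scale1r.
  rewrite big_nat_cond big1 ?add0r => [|i /andP[/andP[_ ij] _]]; last first.
    by rewrite (coord_basis onb) ltn_eqF // scale0r.
  rewrite big_nat_cond big1 ?addr0 // => i /andP[/andP[ij _] _].
  by rewrite (coord_basis onb) gtn_eqF // scale0r.
apply: norm_lim_le (f_cvg x) _ => m.
have := @partialB_le 0 m x `|x| (leq0n _) (normr_ge0 _) (bessel onb m x).
by rewrite [partial 0 x]big_geq // subr0.
Qed.

End ColumnOperator.

(** * Powers and polynomials of an operator *)

Section Powers.
Variables (K : numFieldType) (H : normedModType K).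
Implicit Types (T S : {linear H -> H}) (p : {poly K}) (x y z : H).

Lemma iter_linear T n : linear (iter n T).
Proof. by move=> a x y; elim: n => //= n ->; rewrite linearP. Qed.

Lemma poly_op_linear p T : linear (poly_op p T).
Proof.
move=> a x y; rewrite /poly_op scaler_sumr -big_split /=.
apply: eq_bigr => i _.
by rewrite (@iter_linear T) scalerDr !scalerA mulrC.
Qed.

Lemma poly_opS p T x : poly_op p T (T x) = T (poly_op p T x).
Proof.
rewrite /poly_op linear_sum; apply: eq_bigr => i _ /=.
by rewrite linearZ -iterSr.
Qed.

Lemma norm_iter T R n x : 0 <= R -> (forall z, `|T z| <= R * `|z|) ->
  `|iter n T x| <= R ^+ n * `|x|.
Proof.
move=> R0 TR; elim: n => [|n IH] /=; first by rewrite mul1r.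
by rewrite (le_trans (TR _)) // exprS -mulrA ler_wpM2l.
Qed.

Definition poly_norm p (R : K) : K := \sum_(i < size p) `|p`_i| * R ^+ i.

Lemma poly_norm_ge0 p R : 0 <= R -> 0 <= poly_norm p R.
Proof. by move=> R0; apply: sumr_ge0 => i _; rewrite mulr_ge0 ?exprn_ge0. Qed.

Lemma norm_poly_op p T R x : 0 <= R -> (forall z, `|T z| <= R * `|z|) ->
  `|poly_op p T x| <= poly_norm p R * `|x|.
Proof.
move=> R0 TR; rewrite (le_trans (ler_norm_sum _ _ _)) // mulr_suml.
apply: ler_sum => i _; rewrite normrZ -mulrA ler_wpM2l //.
exact: norm_iter.
Qed.

Lemma iter_perturbation T S R s n x : 0 <= R -> 0 <= s -> 1 <= R ->
  (forall z, `|T z| <= R * `|z|) -> (forall z, `|S z| <= R * `|z|) ->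
  (forall z, `|T z - S z| <= s * `|z|) ->
  `|iter n T x - iter n S x| <= n%:R * R ^+ n * s * `|x|.
Proof.
move=> R0 s0 R1 TR SR TS; elim: n => [|n IH] /=.
  by rewrite subrr normr0 !mul0r.
rewrite -(subrK (T (iter n S x)) (T (iter n T x))) -addrA -linearB.
rewrite (le_trans (ler_normD _ _)) // -natr1 !mulrDl mul1r lerD //.
  rewrite (le_trans (TR _)) //.
  have -> : n%:R * R ^+ n.+1 * s * `|x| = R * (n%:R * R ^+ n * s * `|x|).
    by rewrite exprS; ring.
  exact: ler_wpM2l.
rewrite (le_trans (TS _)) // -mulrA mulrCA ler_wpM2l //.
rewrite (le_trans (norm_iter _ _ R0 SR)) // ler_wpM2r // exprS.
by rewrite ler_peMl // exprn_ge0.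
Qed.

(** A Lipschitz constant of [T |-> p(T)] on the operators of norm at most [R],
for [1 <= R]. *)
Definition poly_sensitivity p (R : K) : K :=
  \sum_(i < size p) `|p`_i| * (i%:R * R ^+ i).

Lemma poly_sensitivity_ge0 p R : 0 <= R -> 0 <= poly_sensitivity p R.
Proof.
by move=> R0; apply: sumr_ge0 => i _; rewrite !mulr_ge0 ?exprn_ge0.
Qed.

Lemma poly_op_perturbation T S R s p x : 0 <= R -> 0 <= s -> 1 <= R ->
  (forall z, `|T z| <= R * `|z|) -> (forall z, `|S z| <= R * `|z|) ->
  (forall z, `|T z - S z| <= s * `|z|) ->
  `|poly_op p T x - poly_op p S x| <= poly_sensitivity p R * s * `|x|.
Proof.
move=> R0 s0 R1 TR SR TS.
rewrite /poly_op -sumrB (le_trans (ler_norm_sum _ _ _)) // /poly_sensitivity.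
rewrite -mulrA mulr_suml; apply: ler_sum => i _.
rewrite -scalerBr normrZ -mulrA ler_wpM2l // mulrA.
exact: iter_perturbation.
Qed.

End Powers.

(** * Powers that are close to polynomials *)

Section Approximation.
Variables (K : numFieldType) (H : completeNormedModType K).
Variables (e : nat -> H) (c : nat -> {scalar H}).
Hypothesis onb : orthonormal_basis e c.

(** The closed span of the [e j] with [n <= j] is invariant under an operator
that is a shift on these vectors, and the weights bound its norm there. *)
Lemma tail_shift (S : {linear H -> H}) (w : nat -> K) (R om : K) n z :
  0 <= om -> (forall z, `|S z| <= R * `|z|) ->
  (forall j, (n <= j)%N -> S (e j) = w j *: e j.+1 /\ `|w j| <= om) ->
  (forall j, (j < n)%N -> c j z = 0) ->
  `|S z| <= om * `|z| /\ (forall j, (j < n)%N -> c j (S z) = 0).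
Proof.
move=> om0 SR Sw cz.
have truncE m : trunc e c m z = \sum_(n <= j < m) c j z *: e j.
  rewrite /trunc; have [nm|/ltnW mn] := leqP n m; last first.
    rewrite (big_geq mn) big_nat_cond big1 // => j /andP[/andP[_ jm] _].
    by rewrite cz ?scale0r // (leq_trans jm).
  rewrite (@big_cat_nat _ _ _ n 0 m) //= big_nat_cond big1 ?add0r //.
  by move=> j /andP[/andP[_ jm] _]; rewrite cz ?scale0r.
have StruncE m : S (trunc e c m z) = \sum_(n <= j < m) c j z *: (w j *: e j.+1).
  rewrite truncE linear_sum; apply: eq_big_nat => j /andP[nj _].
  by rewrite linearZ /= (Sw j nj).1.
split.
  apply: (bounded_le_trunc onb SR) => m; rewrite StruncE.
  apply: (norm_shift_comb onb) => // [j /andP[nj _]|]; first exact: (Sw j nj).2.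
  rewrite -(sqr_norm_comb onb) -truncE ler_sqr ?nnegrE //.
  exact: norm_trunc onb _ _.
have Scvg := bounded_cvg onb SR (trunc_cvg onb (x:=z)).
move=> i im; apply/eqP; rewrite -normr_le0; apply/ler_addgt0Pr => eps eps0.
move/cvgrPdist_lt : Scvg => /(_ _ eps0)[m _ /(_ m (leqnn _))] /ltW Hm.
rewrite add0r (le_trans _ Hm) // (le_trans _ (norm_coord onb i _)) // linearB.
have -> : c i (S (trunc e c m z)) = 0; last by rewrite subr0.
rewrite StruncE linear_sum big_nat_cond big1 // => j /andP[/andP[nj _] _] /=.
by rewrite !linearZ /= (coord_basis onb) ltn_eqF ?mulr0 // ltnS
  (leq_trans _ nj) // ltnW.
Qed.

(** Replacing [T] by [S] costs the first term.  Then [S^n - q(S)] kills the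
projection of [x] on the first [n] basis vectors, and the rest of [x] lies in a
subspace on which [S^n] is bounded by [om ^+ n]. *)
Lemma iter_near_poly (T S : {linear H -> H}) (w : nat -> K) (R s om : K)
    (n : nat) (q : {poly K}) x :
  0 <= om -> 0 <= s -> 1 <= R ->
  (forall z, `|T z| <= R * `|z|) -> (forall z, `|S z| <= R * `|z|) ->
  (forall z, `|T z - S z| <= s * `|z|) ->
  (forall j, (n <= j)%N -> S (e j) = w j *: e j.+1 /\ `|w j| <= om) ->
  (forall j, (j < n)%N -> iter n S (e j) = poly_op q S (e j)) ->
  `|iter n T x - poly_op q T x| <=
    (n%:R * R ^+ n + poly_sensitivity q R) * s * `|x| +
    (om ^+ n + poly_norm q R) * `|x - trunc e c n x|.
Proof.
move=> om0 s0 R1 TR SR TS Sw Sq; have R0 : 0 <= R by exact: le_trans R1.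
set y := trunc e c n x; set z := x - y.
have cz j : (j < n)%N -> c j z = 0.
  by move=> jn; rewrite linearB (coord_trunc onb) jn subrr.
have iterz k : `|iter k S z| <= om ^+ k * `|z| /\
    (forall j, (j < n)%N -> c j (iter k S z) = 0).
  elim: k => [|k [IHn IHc]]; first by rewrite expr0 mul1r.
  have [Sz Sc] := tail_shift om0 SR Sw IHc.
  split=> //; rewrite (le_trans Sz) // exprS -mulrA ler_wpM2l //.
have Sy : iter n S y = poly_op q S y.
  rewrite /y /trunc big_mkord.
  pose f : {linear H -> H} :=
    HB.pack (iter n S) (GRing.isLinear.Build K H H _ _ (@iter_linear _ _ S n)).
  pose g : {linear H -> H} :=
    HB.pack (poly_op q S) (GRing.isLinear.Build K H H _ _ (@poly_op_linear _ _ q S)).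
  rewrite -[LHS]/(f _) -[RHS]/(g _) !linear_sum; apply: eq_bigr => j _.
  by rewrite !linearZ /=; congr (_ *: _); exact: Sq.
have Sx : iter n S x - poly_op q S x = iter n S z - poly_op q S z.
  rewrite -{1 2}(subrK y x) -/z.
  have := @iter_linear _ _ S n 1 z y; rewrite !scale1r => ->.
  have := @poly_op_linear _ _ q S 1 z y; rewrite !scale1r => ->.
  by rewrite Sy opprD addrACA subrr addr0.
have -> : iter n T x - poly_op q T x =
    (iter n T x - iter n S x) - (poly_op q T x - poly_op q S x) +
    (iter n S z - poly_op q S z).
  rewrite -Sx; move: (iter n T x) (iter n S x) (poly_op q T x) => a b p.
  move: (poly_op q S x) => d.
  by rewrite (opprB p) addrACA subrK (addrAC d) subrr add0r.
apply: le_trans (ler_normD _ _) _; apply: lerD.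
  apply: le_trans (ler_normB _ _) _; rewrite !mulrDl; apply: lerD.
    exact: iter_perturbation.
  exact: poly_op_perturbation.
apply: le_trans (ler_normB _ _) _; rewrite mulrDl; apply: lerD.
  exact: (iterz n).1.
exact: norm_poly_op.
Qed.

End Approximation.

(** * Choosing the constants *)

Section Constants.
Variable K : numFieldType.
Hypothesis archK : Num.archimedean_axiom K.

Lemma natr_ge (x : K) : 0 <= x -> exists n : nat, x <= n%:R.
Proof.
move=> x0; have [n] := archK x; rewrite ger0_norm // => /ltW xn.
by exists n.
Qed.

Lemma bernoulli_le (x : K) n : 0 <= x -> 1 + n%:R * x <= (1 + x) ^+ n.
Proof.
move=> x0; elim: n => [|n IH]; first by rewrite mul0r addr0.
rewrite exprS; apply: (@le_trans _ _ ((1 + x) * (1 + n%:R * x))).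
  rewrite -natr1 -subr_ge0.
  have -> : (1 + x) * (1 + n%:R * x) - (1 + (n%:R + 1) * x) = n%:R * x ^+ 2.
    by ring.
  by rewrite mulr_ge0 // exprn_ge0.
by rewrite ler_wpM2l // addr_ge0.
Qed.

(** A companion of Bernoulli's inequality that keeps [(1 + x)^n] bounded while
[n x] stays below [1/2]. *)
Lemma bernoulli_ge (x : K) n : 0 <= x -> (1 + x) ^+ n * (1 - n%:R * x) <= 1.
Proof.
move=> x0; elim: n => [|n IH]; first by rewrite mul0r subr0 mul1r.
apply: le_trans IH; rewrite exprSr -mulrA ler_wpM2l ?exprn_ge0 ?addr_ge0 //.
rewrite -natr1 -subr_ge0.
have -> : 1 - n%:R * x - (1 + x) * (1 - (n%:R + 1) * x) = (n%:R + 1) * x ^+ 2.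
  by ring.
by rewrite mulr_ge0 ?exprn_ge0 // addr_ge0.
Qed.

Lemma expr_unbounded (om A : K) : 1 < om -> 0 <= A ->
  exists n0, forall n, (n0 <= n)%N -> A <= om ^+ n.
Proof.
move=> om1 A0; have x0 : 0 < om - 1 by rewrite subr_gt0.
have [n0 n0P] := natr_ge (divr_ge0 A0 (ltW x0)).
exists n0 => n n0n; rewrite -[om](subrK 1) addrC.
apply: le_trans (bernoulli_le n (ltW x0)).
move: n0P; rewrite ler_pdivrMr // => /le_trans; apply.
apply: (@le_trans _ _ (n%:R * (om - 1))); last by rewrite lerDr.
by rewrite ler_pM2r // ler_nat.
Qed.

(** For a ratio [om'] close to [1], the least power [om' ^+ n] above [L] is
still below [2 L].  Hence the size of [om' ^+ n] can be prescribed, up to a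
factor [2], although [n] has to be large and [om'] close to [1]. *)
Lemma slow_ratio (L om : K) (n0 : nat) : 2 < L -> 1 < om ->
  exists n om', [/\ (n0 <= n)%N, 1 < om', om' <= om, om' ^+ n0 <= 2
    & L <= om' ^+ n <= L * 2].
Proof.
move=> L2 om1; have x0 : 0 < om - 1 by rewrite subr_gt0.
have [m1 m1P] := natr_ge (ltW (divr_gt0 ltr01 x0)).
pose cc := n0.+1; pose m := (m1 + cc * 2)%N.
have m0 : 0 < m%:R :> K by rewrite ltr0n addn_gt0 muln_gt0 orbT.
pose x : K := m%:R^-1; have xp : 0 < x by rewrite invr_gt0.
have om'1 : 1 < 1 + x by rewrite ltrDl.
have pow2 i : (i <= cc)%N -> (1 + x) ^+ i <= 2.
  move=> icc; have := bernoulli_ge i (ltW xp).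
  have : 2^-1 <= 1 - i%:R * x.
    rewrite lerBrDr -lerBrDl.
    have -> : 1 - 2^-1 = 2^-1 :> K by field.
    rewrite ler_pdivrMr // mulrC ler_pdivlMr // -natrM ler_nat.
    by rewrite (leq_trans (leq_mul icc (leqnn 2))) // leq_addl.
  move=> h1 h2; have : (1 + x) ^+ i * 2^-1 <= 1.
    by apply: le_trans h2; rewrite ler_wpM2l // exprn_ge0 // addr_ge0 // ltW.
  by rewrite ler_pdivrMr // mul1r.
have L0 : 0 <= L by rewrite ltW // (lt_trans _ L2).
have exn : exists n, L <= (1 + x) ^+ n.
  have [n Hn] := expr_unbounded om'1 L0; exists n; exact: Hn.
pose n := ex_minn exn; exists n, (1 + x).
rewrite /n; case: ex_minnP => {}n Ln min_n.
split=> //.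
- rewrite leqNgt; apply/negP => nn0.
  have := pow2 n (ltnW (leq_trans nn0 (leqnSn _))).
  by move=> /(le_trans Ln) /(lt_le_trans L2); rewrite ltxx.
- rewrite -lerBrDl /x -[leRHS]invrK lef_pV2 ?posrE ?invr_gt0 //.
  move: m1P; rewrite div1r => /le_trans; apply.
  by rewrite ler_nat leq_addr.
- exact: pow2.
- rewrite Ln /=; case: n Ln min_n => [|n] Ln min_n.
    by rewrite expr0 (le_trans _ (ler_pM _ _ (ltW L2) (lexx 2))) // -natrM ler1n.
  rewrite exprSr ler_pM ?exprn_ge0 ?addr_ge0 ?(ltW xp) //; last first.
    by rewrite -[1 + x]expr1 pow2.
  rewrite ltW // real_ltNge ?ger0_real // ?exprn_ge0 ?addr_ge0 ?(ltW xp) //.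
  by apply/negP => /min_n; rewrite ltnn.
Qed.

Lemma small_square (s : K) : 0 < s ->
  exists d, [/\ 0 < d, d <= 1 & d ^+ 2 <= s].
Proof.
move=> s0; have s1 : 0 < 1 + s by rewrite addr_gt0.
exists (s / (1 + s)); have d0 := divr_gt0 s0 s1.
have d1 : s / (1 + s) <= 1 by rewrite ler_pdivrMr // mul1r lerDr.
split=> //; rewrite expr2 (le_trans (ler_wpM2l (ltW d0) d1)) // mulr1.
by rewrite ler_pdivrMr // ler_peMr ?(ltW s0) // lerDl ltW.
Qed.

End Constants.

(** * Cyclic operators from profiles *)

(** A profile encodes a cyclic operator through the orbit [x_j] of [e 0]: the
entry [j] says that [x_j] is [scale *: e j] plus the combination of the earlier
[x_i] with the coefficients of [feedback].  Since [T x_j = x_(j+1)], this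
determines the column [T (e j)].  The weight of the shift to which that column
is compared is [ratio]. *)
Record profile_entry (K : numFieldType) := ProfileEntry
  { scale : K; feedback : {poly K}; ratio : K }.

Section Profile.
Variables (K : numFieldType) (H : completeNormedModType K) (e : nat -> H).
Implicit Types (f : nat -> profile_entry K) (p : {poly K}).

(** The list of [x_0], ..., [x_(n-1)]: each [x_j] refers to all earlier ones. *)
Fixpoint orbit_seq f n : seq H :=
  if n is n'.+1 then
    rcons (orbit_seq f n') (scale (f n') *: e n' +
      \sum_(i < n') (feedback (f n'))`_i *: nth 0 (orbit_seq f n') i)
  else [::].

Definition orbit_vec f j := nth 0 (orbit_seq f j.+1) j.

(** The image of [p] under the linear map [X^j |-> x_j], that is [p(T) e_0]. *)
Definition orbit_comb f p := \sum_(i < size p) p`_i *: orbit_vec f i.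

(** The value of [T (e j)] forced by [T x_j = x_(j+1)], as
[e j = (x_j - orbit_comb (feedback (f j))) / scale (f j)]. *)
Definition column f j :=
  (scale (f j))^-1 *: (orbit_vec f j.+1 - orbit_comb f (feedback (f j) * 'X)).

Definition column_error f j := column f j - ratio (f j) *: e j.+1.

Lemma size_orbit_seq f n : size (orbit_seq f n) = n.
Proof. by elim: n => //= n IH; rewrite size_rcons IH. Qed.

Lemma nth_orbit_seq f n i : (i < n)%N -> nth 0 (orbit_seq f n) i = orbit_vec f i.
Proof.
elim: n => // n IH; rewrite ltnS leq_eqVlt => /orP[/eqP -> //|ltin] /=.
by rewrite nth_rcons size_orbit_seq ltin IH.
Qed.

Lemma orbit_comb_widen f p n : (size p <= n)%N ->
  orbit_comb f p = \sum_(i < n) p`_i *: orbit_vec f i.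
Proof.
move=> pn; rewrite /orbit_comb (big_ord_widen n (fun i => p`_i *: orbit_vec f i)) //.
rewrite big_mkcond /=; apply: eq_bigr => i _.
by case: ltnP => // pi; rewrite nth_default // scale0r.
Qed.

Lemma orbit_comb_linear f : linear (orbit_comb f).
Proof.
move=> a p q; pose n := maxn (size p) (size q).
have apq : (size (a *: (p : {poly K}) + (q : {poly K}))%R <= n)%N.
  rewrite (leq_trans (size_polyD _ _)) // geq_max leq_maxr andbT.
  by rewrite (leq_trans (size_scale_leq _ _)) // leq_maxl.
rewrite !(@orbit_comb_widen _ _ n) ?leq_maxl ?leq_maxr //.
rewrite scaler_sumr -big_split /=; apply: eq_bigr => i _.
by rewrite coefD coefZ scalerDl scalerA.
Qed.

HB.instance Definition _ f :=
  GRing.isLinear.Build K {poly K} H _ (orbit_comb f) (@orbit_comb_linear f).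

Lemma orbit_combX f k p : orbit_comb f ('X^k * p) =
  \sum_(i < size p) p`_i *: orbit_vec f (k + i).
Proof.
rewrite (@orbit_comb_widen _ _ (k + size p)); last first.
  by rewrite (leq_trans (size_polyMleq _ _)) // size_polyXn.
rewrite big_split_ord /= big1 ?add0r => [|i _]; last first.
  by rewrite coefXnM ltn_ord scale0r.
apply: eq_bigr => i _; rewrite coefXnM ltnNge leq_addr /=.
by rewrite addKn.
Qed.

Lemma orbit_vecE f j : (size (feedback (f j)) <= j)%N ->
  orbit_vec f j = scale (f j) *: e j + orbit_comb f (feedback (f j)).
Proof.
move=> szj; rewrite {1}/orbit_vec /= nth_rcons size_orbit_seq ltnn eqxx.
rewrite (orbit_comb_widen f szj); congr (_ + _).
by apply: eq_bigr => i _; rewrite nth_orbit_seq.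
Qed.

(** The last term measures how far the feedback is from being shifted along:
the error is small when [feedback (f j.+1)] is close to
[feedback (f j) * 'X]. *)
Lemma column_errorE f j : (size (feedback (f j.+1)) <= j.+1)%N ->
  column_error f j = (scale (f j.+1) / scale (f j) - ratio (f j)) *: e j.+1 +
    (scale (f j))^-1 *:
      orbit_comb f (feedback (f j.+1) - feedback (f j) * 'X).
Proof.
move=> szj; rewrite /column_error /column orbit_vecE //.
rewrite (linearB (orbit_comb f)) /= -addrA scalerDr scalerA.
rewrite [_^-1 * scale _]mulrC [RHS]addrC scalerBl [RHS]addrCA [LHS]addrAC.
by rewrite -!addrA; congr (_ + _); rewrite addrC.
Qed.

Definition same_entry (a b : profile_entry K) : Prop :=
  scale a = scale b /\ feedback a = feedback b.

Lemma eq_orbit_vec f f' j : (forall i, (i <= j)%N -> same_entry (f i) (f' i)) ->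
  orbit_vec f j = orbit_vec f' j.
Proof.
move=> ff'; rewrite /orbit_vec; congr (nth _ _ _).
have : forall i, (i < j.+1)%N -> same_entry (f i) (f' i) by [].
elim: j.+1 => //= n IH Hn; have [-> ->] := Hn n (ltnSn n).
by rewrite IH // => i ltin; apply: Hn; exact: ltnW.
Qed.

Lemma eq_orbit_comb f f' p n : (size p <= n)%N ->
  (forall i, (i < n)%N -> same_entry (f i) (f' i)) ->
  orbit_comb f p = orbit_comb f' p.
Proof.
move=> pn ff'; apply: eq_bigr => i _; congr (_ *: _).
apply: eq_orbit_vec => k ki; apply: ff'.
by rewrite (leq_ltn_trans ki) // (leq_trans _ pn).
Qed.

Lemma eq_column_error f f' n j : (j.+1 < n)%N ->
  (size (feedback (f j)) <= j)%N -> (size (feedback (f j.+1)) <= j.+1)%N ->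
  (forall i, (i < n)%N -> f i = f' i) ->
  column_error f j = column_error f' j.
Proof.
move=> jn sj sj1 ff'; have fj := ff' j (ltnW jn); have fj1 := ff' j.+1 jn.
have ss i : (i < n)%N -> same_entry (f i) (f' i) by move=> /ff' ->.
rewrite /column_error /column -fj; congr (_ *: (_ - _) - _).
  by apply: eq_orbit_vec => i ij; apply: ss; exact: leq_ltn_trans jn.
apply: (eq_orbit_comb _ ss); rewrite (leq_trans (size_polyMleq _ _)) //.
by rewrite size_polyX addn2 /= (leq_trans _ (ltnW jn)).
Qed.

End Profile.

(** * Adding one block *)

Section Block.
Variables (K : numFieldType) (H : completeNormedModType K) (e : nat -> H).
Hypothesis norm_e : forall j, `|e j| = 1.
Variables (f : nat -> profile_entry K) (N n M : nat) (b d om om' : K).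
Variable q : {poly K}.

(** The first phase of a block, continued forever.  It does not depend on [n],
so the norm of [q] can be measured in it before [n] is chosen. *)
Definition climb_profile (j : nat) : profile_entry K :=
  if (j < N)%N then f j else ProfileEntry (b * om ^+ (j - N)) 0 om.

(** A block climbs from [N] to [n] with pure powers of [X] and fades from [n] to
[n + M], where the orbit vector is again a multiple of the basis vector because
the coefficient [1 - M / M] of the feedback vanishes.  The ratio is [0] at the
two places where a weak link replaces the shift. *)
Definition block_profile (j : nat) : profile_entry K :=
  if (j < N)%N then f j
  else if (j < n)%N then
    ProfileEntry (b * om ^+ (j - N)) 0 (if j.+1 == n then 0 else om)
  else ProfileEntry (d * om' ^+ (j - n))
    ((1 - (j - n)%:R / M%:R) *: ('X^(j - n) * q))
    (if j == (n + M)%N then 0 else om').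

Let F := block_profile.

Hypothesis N0 : (0 < N)%N.
Hypothesis Nn : (N < n)%N.
Hypothesis M0 : (0 < M)%N.
Hypothesis b0 : 0 < b.
Hypothesis d0 : 0 < d.
Hypothesis om1 : 1 < om.
Hypothesis om'1 : 1 < om'.
Hypothesis szq : (size q <= n)%N.
Hypothesis f_last : feedback (f N.-1) = 0.
Hypothesis f_ratio : ratio (f N.-1) = 0.
Hypothesis f_size : forall j, (j < N)%N -> (size (feedback (f j)) <= j)%N.
Hypothesis f_scale : forall j, (j < N)%N -> scale (f j) != 0.

Lemma block_profile_old j : (j < N)%N -> F j = f j.
Proof. by rewrite /F /block_profile => ->. Qed.

Lemma block_profile_climb j : (N <= j < n)%N -> F j =
  ProfileEntry (b * om ^+ (j - N)) 0 (if j.+1 == n then 0 else om).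
Proof. by move=> /andP[Nj jn]; rewrite /F /block_profile ltnNge Nj jn. Qed.

Lemma block_profile_fade i : F (n + i) = ProfileEntry (d * om' ^+ i)
  ((1 - i%:R / M%:R) *: ('X^i * q)) (if i == M then 0 else om').
Proof.
rewrite /F /block_profile !ltnNge leq_addr (leq_trans (ltnW Nn) (leq_addr _ _)).
by rewrite /= addKn eqn_add2l.
Qed.

Lemma same_climb j : (j < n)%N -> same_entry (climb_profile j) (F j).
Proof.
by rewrite /F /climb_profile /block_profile => jn; case: ltnP => // _; rewrite jn.
Qed.

Lemma block_scale j : scale (F j) != 0.
Proof.
have [jn|/subnKC <-] := ltnP j n; last first.
  by rewrite block_profile_fade /= gt_eqF // mulr_gt0 // exprn_gt0 // (lt_trans ltr01).
have [jN|Nj] := ltnP j N; first by rewrite block_profile_old // f_scale.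
rewrite block_profile_climb ?Nj //= gt_eqF // mulr_gt0 // exprn_gt0 //.
exact: lt_trans ltr01 om1.
Qed.

Lemma block_size j : (size (feedback (F j)) <= j)%N.
Proof.
have [jn|/subnKC <-] := ltnP j n; last first.
  rewrite block_profile_fade /= (leq_trans (size_scale_leq _ _)) //.
  rewrite (leq_trans (size_polyMleq _ _)) // size_polyXn addSn /= addnC.
  by rewrite leq_add2r.
have [jN|Nj] := ltnP j N; first by rewrite block_profile_old // f_size.
by rewrite block_profile_climb ?Nj //= size_poly0.
Qed.

Lemma error_link_in : column_error e F N.-1 = (b / scale (f N.-1)) *: e N.
Proof.
rewrite column_errorE ?block_size // prednK // [F N.-1]block_profile_old ?ltn_predL //.
rewrite block_profile_climb ?leqnn ?Nn //= f_last f_ratio subnn expr0 mulr1.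
by rewrite mul0r subrr (linear0 (orbit_comb e F)) scaler0 subr0 addr0.
Qed.

Lemma error_climb j : (N <= j)%N -> (j.+1 < n)%N -> column_error e F j = 0.
Proof.
move=> Nj jn; rewrite column_errorE ?block_size //.
rewrite !block_profile_climb ?Nj ?(leqW Nj) ?(ltnW jn) ?jn //=.
rewrite (ltn_eqF jn) mul0r subrr (linear0 (orbit_comb e F)) scaler0 addr0 subSn // exprS.
have omj : om ^+ (j - N) != 0 by rewrite expf_neq0 // gt_eqF // (lt_trans ltr01).
have -> : b * (om * om ^+ (j - N)) / (b * om ^+ (j - N)) = om.
  by rewrite mulrCA mulfK // mulf_neq0 // gt_eqF.
by rewrite subrr scale0r.
Qed.

(** At the turn the small vector [d *: e n] represents [X^n - q], so that
[X^n] is [q] up to [d *: e n]. *)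
Lemma error_turn : column_error e F n.-1 =
  (scale (F n.-1))^-1 *: (d *: e n + orbit_comb e F q).
Proof.
have nS : n.-1.+1 = n by rewrite prednK // (leq_trans _ Nn).
have En1 : F n.-1 = ProfileEntry (b * om ^+ (n.-1 - N)) 0 0.
  have Nn1 : (N <= n.-1 < n)%N by apply/andP; split; [rewrite -ltnS nS | rewrite -{2}nS].
  by rewrite (block_profile_climb Nn1) nS eqxx.
have En : F n = ProfileEntry d q om'.
  rewrite -(addn0 n) block_profile_fade expr0 mulr1 mul0r subr0 scale1r.
  by rewrite mul1r eq_sym gtn_eqF.
rewrite column_errorE ?block_size // nS En En1 /=.
by rewrite mul0r !subr0 scalerDr scalerA (mulrC d).
Qed.

(** [t_(i+1) X^(i+1) q - t_i X^i q X] with [t_i = 1 - i / M] leaves only the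
step [1 / M] of [t]. *)
Lemma error_fade i : (i < M)%N -> column_error e F (n + i) =
  - (M%:R * (d * om' ^+ i))^-1 *: orbit_comb e F ('X^(i.+1) * q).
Proof.
move=> iM; rewrite column_errorE ?block_size // -addnS !block_profile_fade /=.
rewrite (ltn_eqF iM).
have omi : om' ^+ i != 0 by rewrite expf_neq0 // gt_eqF // (lt_trans ltr01).
have dn0 : d != 0 by rewrite gt_eqF.
have Mn0 : M%:R != 0 :> K by rewrite pnatr_eq0 -lt0n.
have -> : d * om' ^+ i.+1 / (d * om' ^+ i) = om'.
  by rewrite exprS mulrCA mulfK // mulf_neq0.
rewrite subrr scale0r add0r.
have -> : (1 - i.+1%:R / M%:R) *: ('X^(i.+1) * q) -
    (1 - i%:R / M%:R) *: ('X^i * q) * 'X = - M%:R^-1 *: ('X^(i.+1) * q).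
  rewrite -scalerAl mulrAC -exprSr -scalerBl; congr (_ *: _).
  by rewrite -natr1; field.
by rewrite linearZ scalerA /= mulrN !invfM mulrC.
Qed.

Lemma norm_orbit_comb_le C k : (size q + k <= (n + M).+1)%N -> 0 <= C ->
  (forall l, (l < size q + k)%N -> `|orbit_vec e F l| <= C * om' ^+ l) ->
  `|orbit_comb e F ('X^k * q)| <=
    poly_norm q 1 * (C * om' ^+ ((size q).-1 + k)).
Proof.
move=> qk C0 Cl; rewrite orbit_combX (le_trans (ler_norm_sum _ _ _)) //.
rewrite /poly_norm mulr_suml; apply: ler_sum => i _.
rewrite normrZ expr1n mulr1 ler_wpM2l //.
rewrite (le_trans (Cl _ _)) ?ler_wpM2l //; first by rewrite addnC ltn_add2r.
apply: ler_weXn2l; first exact: ltW.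
by rewrite addnC leq_add2r -ltnS (ltn_predK (ltn_ord i)).
Qed.

Hypothesis d1 : d <= 1.
Hypothesis om'q : om' ^+ size q <= 2.
Hypothesis om'n : 1 + poly_norm q 1 * 2 <= om' ^+ n.

(** In [x_(n+i) = d om'^i e_(n+i) + t X^i q] the second term is at most
[|q|_1 C om'^(i + size q)] by induction; as [om'^(size q) <= 2], the sum stays
below [C om'^(n+i)] once [1 + 2 |q|_1 <= om'^n]. *)
Lemma orbit_vec_growth C : 1 <= C ->
  (forall l, (l < n)%N -> `|orbit_vec e F l| <= C) ->
  forall l, (l <= n + M)%N -> `|orbit_vec e F l| <= C * om' ^+ l.
Proof.
move=> C1 Cn; have C0 : 0 <= C by exact: le_trans C1.
have om'0 : 0 <= om' by rewrite ltW // (lt_trans ltr01).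
elim/ltn_ind => l IH lnM; have [ln|/subnKC ln] := ltnP l n.
  by rewrite (le_trans (Cn _ ln)) // ler_peMr // exprn_ege1 // ltW.
move: (l - n)%N ln => i ln; subst l.
rewrite orbit_vecE ?block_size // block_profile_fade /= linearZ /=.
rewrite (le_trans (ler_normD _ _)) // !normrZ norm_e mulr1.
rewrite leq_add2l in lnM.
have dp : 0 <= d * om' ^+ i by rewrite mulr_ge0 ?exprn_ge0 // ltW.
rewrite -normrM [`|d * _|](ger0_norm dp).
have t1 : `|1 - i%:R / M%:R : K| <= 1.
  have iM1 : i%:R / M%:R <= 1 :> K by rewrite ler_pdivrMr ?ltr0n // mul1r ler_nat.
  rewrite ger0_norm; last by rewrite subr_ge0.
  by rewrite gerBl // divr_ge0.
have p0 : 0 <= poly_norm q 1 by rewrite poly_norm_ge0.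
have h : `|orbit_comb e F ('X^i * q)| <= poly_norm q 1 * (C * (2 * om' ^+ i)).
  apply: le_trans (norm_orbit_comb_le (C := C) (k := i) _ _ _) _ => //.
  - by rewrite (leq_trans (leq_add szq lnM)).
  - move=> l lq; apply: IH.
      by rewrite (leq_trans lq) // leq_add2r.
    by rewrite (leq_trans (ltnW lq)) // leq_add.
  rewrite ler_wpM2l // ler_wpM2l // exprD ler_wpM2r ?exprn_ge0 //.
  apply: le_trans om'q; apply: ler_weXn2l; [exact: ltW|exact: leq_pred].
apply: (@le_trans _ _ (C * om' ^+ i * (1 + poly_norm q 1 * 2))); last first.
  by rewrite exprD [om' ^+ n * _]mulrC mulrA ler_wpM2l // mulr_ge0 ?exprn_ge0.
rewrite mulrDr mulr1 lerD //.
  by rewrite ler_wpM2r ?exprn_ge0 // (le_trans d1).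
apply: le_trans (ler_wpM2r (normr_ge0 _) t1) _; rewrite mul1r.
by apply: (le_trans h); rewrite le_eqVlt; apply/orP; left; apply/eqP; ring.
Qed.

Lemma norm_error_fade C i : 1 <= C -> (i < M)%N ->
  (forall l, (l < n)%N -> `|orbit_vec e F l| <= C) ->
  `|column_error e F (n + i)| <= poly_norm q 1 * C * 2 * om' / d / M%:R.
Proof.
move=> C1 iM Cn; rewrite error_fade // normrZ normrN.
have C0 : 0 <= C by exact: le_trans C1.
have om'0 : 0 < om' by rewrite (lt_trans ltr01).
have M1 : 0 < M%:R :> K by rewrite ltr0n.
have D0 : 0 < M%:R * (d * om' ^+ i) by rewrite !mulr_gt0 // exprn_gt0.
rewrite normfV (gtr0_norm D0) [_^-1 * _]mulrC ler_pdivrMr //.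
have -> : poly_norm q 1 * C * 2 * om' / d / M%:R * (M%:R * (d * om' ^+ i)) =
    poly_norm q 1 * (C * (2 * om' ^+ i.+1)).
  by rewrite exprS; field; rewrite !gt_eqF.
apply: le_trans (norm_orbit_comb_le (C := C) (k := i.+1) _ _ _) _ => //.
- by rewrite (leq_trans (leq_add szq iM)).
- move=> l lq; apply: orbit_vec_growth => //.
  by rewrite (leq_trans (ltnW lq)) // leq_add.
rewrite ler_wpM2l ?poly_norm_ge0 // ler_wpM2l // exprD.
rewrite ler_wpM2r ?exprn_ge0 ?(ltW om'0) //.
apply: le_trans om'q; apply: ler_weXn2l; [exact: ltW|exact: leq_pred].
Qed.

End Block.

(** The state between two blocks: a profile that is settled below [len], the
current ratio of the shift, and the sum of squared column errors that may still
be spent. *)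
Record stage (K : numFieldType) := Stage
  { profile : nat -> profile_entry K; len : nat; rate : K; budget : K }.

Definition stage_ok (K : numFieldType) (st : stage K) : Prop :=
  [/\ (0 < len st)%N,
      forall j, (j < len st)%N -> scale (profile st j) != 0 /\
        (size (feedback (profile st j)) <= j)%N,
      feedback (profile st (len st).-1) = 0 /\
        ratio (profile st (len st).-1) = 0,
      1 < rate st
    & 0 < budget st].

Section NextBlock.
Variables (K : numFieldType) (H : completeNormedModType K) (e : nat -> H).
Hypothesis archK : Num.archimedean_axiom K.
Hypothesis norm_e : forall j, `|e j| = 1.

Definition sqr_error (f : nat -> profile_entry K) l m : K :=
  \sum_(l <= j < m) `|column_error e f j| ^+ 2.

(** What remains of the column at the turn once the feedback [q] is removed. *)
Definition turn_link (f : nat -> profile_entry K) n q : H :=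
  column_error e f n.-1 - (scale (f n.-1))^-1 *: orbit_comb e f q.

(** This exceeds both [2], as needed to choose the ratio, and [1 + 2 |q|_1], as
needed for the growth of the orbit during the fade. *)
Definition rate_bound (q : {poly K}) : K := 3 + poly_norm q 1 * 2.

(** The tolerance [sg] is fixed after [n] by [next_precision]; by [next_link] it
bounds everything that happens from the turn on, including the budget left to
all later blocks. *)
Record next_block (q : {poly K}) (eps : K) (st st' : stage K) (n : nat)
    (sg : K) : Prop := NextBlock {
  next_len : (len st < n < len st')%N;
  next_size : (size q <= n)%N;
  next_old : forall j, (j < len st)%N -> profile st' j = profile st j;
  next_rate : rate st' <= rate st;
  next_ratio_climb : forall j, (len st <= j < n)%N ->
    `|ratio (profile st' j)| <= rate st;
  next_ratio_fade : forall j, (n <= j < len st')%N ->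
    `|ratio (profile st' j)| <= rate st';
  next_turn : feedback (profile st' n.-1) = 0 /\ ratio (profile st' n.-1) = 0;
  next_sg : 0 < sg;
  next_budget : sqr_error (profile st') (len st).-1 (len st').-1 + budget st'
    <= budget st;
  next_link : `|turn_link (profile st') n q| ^+ 2 +
    sqr_error (profile st') n (len st').-1 + budget st' <= sg ^+ 2;
  next_power : rate st' ^+ n <= rate_bound q * 2;
  next_precision : (n%:R * 4 ^+ n + poly_sensitivity q 4) * sg <= eps }.

(** The order of the choices: the first link [del]; the climb, long enough to
make the turn small; the ratio [om'] together with [n]; the tolerance [sg]; the
second link [d]; and at last the number [M] of steps of the fade, which depends
on all of these through the constant [D] of its column errors. *)
Lemma next_block_exists (st : stage K) q eps : stage_ok st -> 0 < eps ->
  exists st' n sg, stage_ok st' /\ next_block q eps st st' n sg.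
Proof.
case: st => f N om s [/= N0 fN [f_last f_ratio] om1 s0] eps0.
have om0 : 0 < om by rewrite (lt_trans ltr01).
have s4 : 0 < s / 4 by rewrite divr_gt0.
have [del [del0 del1 del2]] := small_square s4.
have fN1 : scale (f N.-1) != 0 by have [|] := fN N.-1; rewrite ?ltn_predL.
pose b := `|scale (f N.-1)| * del.
have b0 : 0 < b by apply: mulr_gt0 => //; rewrite normr_gt0.
pose F0 := climb_profile f N b om.
pose A := 1 + `|orbit_comb e F0 q|.
have A0 : 0 <= A by rewrite addr_ge0.
have [n1 n1P] := expr_unbounded archK om1 (divr_ge0 A0 (ltW (mulr_gt0 b0 del0))).
pose n0 := (N + n1 + size q + 2)%N.
have p0 : 0 <= poly_norm q 1 by rewrite poly_norm_ge0.
have L2 : 2 < rate_bound q.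
  by rewrite /rate_bound ltr_wpDr ?mulr_ge0 // ltr_nat.
have [n [om' [n0n om'1 om'om om'n0 /andP[om'L om'U]]]] :=
  slow_ratio archK n0 L2 om1.
have om'0 : 0 < om' by rewrite (lt_trans ltr01).
have Nn : (N < n)%N by move: n0n; rewrite /n0; clear; lia.
have szq : (size q <= n)%N by move: n0n; rewrite /n0; clear; lia.
have om'q : om' ^+ size q <= 2.
  apply: le_trans om'n0; apply: ler_weXn2l; first exact: ltW.
  by rewrite /n0; clear; lia.
have om'n : 1 + poly_norm q 1 * 2 <= om' ^+ n.
  by apply: le_trans om'L; rewrite lerD2r ler1n.
pose B := b * om ^+ (n.-1 - N).
have B0 : 0 < B by apply: mulr_gt0 => //; rewrite exprn_gt0.
(* [B] is the scale at the end of the climb, so the turn has norm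
at most [A / B]. *)
have AB : A <= del * B.
  have := n1P (n.-1 - N)%N; rewrite (ler_pdivrMr _ _ (mulr_gt0 b0 del0)) /B => AB.
  rewrite mulrA [del * b]mulrC [leRHS]mulrC; apply: AB.
  by move: n0n; rewrite /n0; clear; lia.
pose W := n%:R * 4 ^+ n + poly_sensitivity q 4.
have W0 : 0 <= W.
  by rewrite addr_ge0 ?poly_sensitivity_ge0 // mulr_ge0 // exprn_ge0.
have We0 : 0 < W + eps by rewrite ltr_wpDl.
have [sg [sg0 sg2 Wsg]] : exists sg, [/\ 0 < sg, sg ^+ 2 <= s / 4 & W * sg <= eps].
  exists (del * (eps / (W + eps))).
  have y0 : 0 < eps / (W + eps) by rewrite divr_gt0.
  have y1 : eps / (W + eps) <= 1 by rewrite ler_pdivrMr // mul1r lerDr.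
  split; first by rewrite mulr_gt0.
    rewrite exprMn (le_trans _ del2) // ler_piMr ?exprn_ge0 ?(ltW del0) //.
    by rewrite exprn_ile1 // ltW.
  rewrite mulrCA (le_trans (ler_piMl _ del1)) //; last first.
    by rewrite mulrCA ler_piMr ?(ltW eps0) // ler_pdivrMr // mul1r lerDl ltW.
  by rewrite mulr_ge0 // ltW.
(* [z / (1 + z)] is below both [z] and [1]. *)
have [d [d0 d1 dB]] : exists d, [/\ 0 < d, d <= 1 & d <= sg / 2 * B].
  have z0 : 0 < sg / 2 * B by rewrite mulr_gt0 // divr_gt0.
  have z1 : 0 < 1 + sg / 2 * B by rewrite addr_gt0.
  exists (sg / 2 * B / (1 + sg / 2 * B)); split; first by rewrite divr_gt0.
    by rewrite ler_pdivrMr // mul1r lerDr.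
  by rewrite ler_pdivrMr // ler_peMr ?(ltW z0) // lerDl ltW.
pose C := 1 + \sum_(l < n) `|orbit_vec e F0 l|.
have C1 : 1 <= C by rewrite lerDl sumr_ge0.
have C0 : 0 <= C by exact: le_trans C1.
pose D := poly_norm q 1 * C * 2 * om' / d.
have D0 : 0 <= D.
  by rewrite /D divr_ge0 ?(ltW d0) // !mulr_ge0 // ltW.
have sg24 : 0 < sg ^+ 2 / 4 by rewrite divr_gt0 // exprn_gt0.
have [M' M'P] := natr_ge archK (divr_ge0 (exprn_ge0 2 D0) (ltW sg24)).
pose M := M'.+1.
have MD : D ^+ 2 <= sg ^+ 2 / 4 * M%:R.
  rewrite mulrC -ler_pdivrMr // (le_trans M'P) // ler_nat; exact: leqnSn.
have M0 : (0 < M)%N by [].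
have M1 : 0 < M%:R :> K by rewrite ltr0n.
pose F := block_profile f N n M b d om om' q.
have fsz j : (j < N)%N -> (size (feedback (f j)) <= j)%N by move=> /fN [].
have fsc j : (j < N)%N -> scale (f j) != 0 by move=> /fN [].
have Fsize : forall j, (size (feedback (F j)) <= j)%N by exact: block_size.
have Fscale : forall j, scale (F j) != 0 by exact: block_scale.
have F0F j : (j < n)%N -> same_entry (F0 j) (F j) by move=> jn; exact: same_climb.
have n_1 : n.-1.+1 = n by rewrite prednK // (leq_trans _ Nn).
have Nn1 : (N <= n.-1 < n)%N by apply/andP; split; [rewrite -ltnS n_1|rewrite -{2}n_1].
have Fn1 : F n.-1 = ProfileEntry B 0 0.
  by rewrite /F block_profile_climb // n_1 eqxx.
have turnE : column_error e F n.-1 = B^-1 *: (d *: e n + orbit_comb e F q).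
  by rewrite error_turn // -/F Fn1.
have linkE : turn_link F n q = (d / B) *: e n.
  by rewrite /turn_link turnE Fn1 /= scalerDr addrK scalerA mulrC.
have fade i : (i < M)%N -> `|column_error e F (n + i)| ^+ 2 <= D ^+ 2 / M%:R ^+ 2.
  have DM0 : 0 <= D / M%:R by apply: divr_ge0 => //; exact: ltW.
  move=> iM; rewrite -expr_div_n ler_sqr ?nnegrE //.
  apply: norm_error_fade => // l ln.
  rewrite -(@eq_orbit_vec _ _ e F0 F); last first.
    by move=> i' i'l; apply: F0F; exact: leq_ltn_trans ln.
  by rewrite /C (bigD1 (Ordinal ln)) //= addrCA lerDl addr_ge0 // sumr_ge0 //.
have fade_sum : sqr_error F n (n + M) <= sg ^+ 2 / 4.
  rewrite /sqr_error -{1}[n]add0n big_addn addKn big_mkord.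
  apply: (@le_trans _ _ (\sum_(i < M) D ^+ 2 / M%:R ^+ 2)).
    by apply: ler_sum => i _; rewrite addnC fade.
  rewrite sumr_const card_ord -[_ *+ _](mulr_natr (D ^+ 2 / _)).
  have -> : D ^+ 2 / M%:R ^+ 2 * M%:R = D ^+ 2 / M%:R.
    by field; rewrite gt_eqF.
  by rewrite ler_pdivrMr.
have sg2s : sg ^+ 2 / 4 <= s / 4.
  apply: le_trans sg2; rewrite ler_pdivrMr // ler_peMr ?exprn_ge0 ?(ltW sg0) //.
  by rewrite ler1n.
exists (Stage F (n + M).+1 om' (sg ^+ 2 / 4)), n, sg; split.
  split=> //=.
    by split; rewrite /F block_profile_fade //= ?eqxx // divff ?subrr ?scale0r // gt_eqF.
have errN : `|column_error e F N.-1| ^+ 2 <= s / 4.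
  rewrite error_link_in // normrZ norm_e mulr1 normrM normfV (gtr0_norm b0) /b.
  by rewrite mulrAC divff ?mul1r // normr_eq0.
have errn : `|column_error e F n.-1| ^+ 2 <= s / 4.
  apply: le_trans del2; rewrite ler_sqr ?nnegrE ?(ltW del0) // turnE normrZ.
  rewrite normfV (gtr0_norm B0) mulrC ler_pdivrMr // (le_trans _ AB) //.
  rewrite (le_trans (ler_normD _ _)) // normrZ norm_e mulr1 (gtr0_norm d0).
  by rewrite /A (eq_orbit_comb _ szq F0F) lerD.
have linkn : `|turn_link F n q| ^+ 2 <= sg ^+ 2 / 4.
  rewrite linkE normrZ norm_e mulr1 gtr0_norm ?divr_gt0 //.
  have -> : sg ^+ 2 / 4 = (sg / 2) ^+ 2 by field.
  have sg_half : 0 <= sg / 2 by rewrite divr_ge0 // ltW.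
  by rewrite ler_sqr ?nnegrE ?(ltW (divr_gt0 d0 B0)) // ler_pdivrMr.
split=> //=.
- by rewrite Nn /= ltnS leq_addr.
- exact: block_profile_old.
- move=> j jn; rewrite /F block_profile_climb //=.
  by case: ifP; rewrite ?normr0 ?(ltW om0) // gtr0_norm.
- move=> j /andP[/subnKC <- _]; rewrite /F block_profile_fade //=.
  by case: ifP; rewrite ?normr0 ?(ltW om'0) // gtr0_norm.
- by rewrite -/F Fn1.
- rewrite -/F.
  have E1 : sqr_error F N.-1 (n + M) = `|column_error e F N.-1| ^+ 2 +
      (`|column_error e F n.-1| ^+ 2 + sqr_error F n (n + M)).
    have h1 : (N.-1 < n + M)%N.
      by rewrite (leq_trans _ (leq_addr _ _)) // (leq_ltn_trans (leq_pred _)).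
    rewrite /sqr_error big_ltn // (prednK N0); congr (_ + _).
    have [h2 h3] := andP Nn1.
    rewrite (@big_cat_nat _ _ _ n.-1) //=; last first.
      by rewrite (leq_trans (ltnW h3)) // leq_addr.
    rewrite big_nat_cond big1 ?add0r => [|j /andP[/andP[Nj jn] _]]; last first.
      by rewrite error_climb ?normr0 ?expr0n // -n_1 ltnS.
    by rewrite big_ltn ?n_1 // leq_addr.
  have -> : s = s / 4 + (s / 4 + s / 4) + s / 4 by field.
  rewrite E1 lerD // lerD // lerD //.
  exact: le_trans fade_sum sg2s.
- rewrite -/F.
  apply: (@le_trans _ _ (sg ^+ 2 / 4 + sg ^+ 2 / 4 + sg ^+ 2 / 4)).
    by rewrite !lerD.
  have -> : sg ^+ 2 / 4 + sg ^+ 2 / 4 + sg ^+ 2 / 4 = sg ^+ 2 - sg ^+ 2 / 4 by field.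
  by rewrite gerBl ltW.
Qed.

End NextBlock.

(** * The limit operator *)

Section Stages.
Variables (K : numFieldType) (H : completeNormedModType K).
Hypothesis archK : Num.archimedean_axiom K.
Variables (e : nat -> H) (c : nat -> {scalar H}).
Hypothesis onb : orthonormal_basis e c.
Variable Q : nat -> {poly K}.

Let norm_e := norm_basis onb.

Lemma stages : exists (S : nat -> stage K) (n_ : nat -> nat) (sg : nat -> K),
  [/\ S 0 = Stage (fun=> ProfileEntry 1 0 0) 1 2 1,
      forall k, stage_ok (S k)
    & forall k, next_block e (Q k) k.+1%:R^-1 (S k) (S k.+1) (n_ k) (sg k)].
Proof.
pose X := (nat * {st : stage K | stage_ok st})%type.
pose R (x y : X) : Prop := y.1 = x.1.+1 /\
  exists n sg, next_block e (Q x.1) x.1.+1%:R^-1 (sval x.2) (sval y.2) n sg.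
have step x : {y | R x y}.
  apply: cid; case: x => k [st st_ok].
  have k0 : 0 < k.+1%:R^-1 :> K by rewrite invr_gt0 ltr0n.
  have [st' [n [sg [st'_ok nb]]]] := next_block_exists archK norm_e (Q k) st_ok k0.
  by exists (k.+1, exist _ st' st'_ok); split=> //=; exists n, sg.
have st0_ok : stage_ok (Stage (fun=> ProfileEntry (1 : K) 0 0) 1 2 1).
  split=> //=; last by rewrite ltr1n.
  by move=> j _; rewrite oner_eq0 size_poly0.
have [G [G0 GR]] := dependent_choice step (0, exist _ _ st0_ok).
have G1 k : (G k).1 = k by elim: k => [|k IH]; rewrite ?G0 // (GR k).1 IH.
have : forall k, exists p : nat * K, next_block e (Q k) k.+1%:R^-1
    (sval (G k).2) (sval (G k.+1).2) p.1 p.2.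
  by move=> k; have [_ [n [sg]]] := GR k; rewrite G1 => nb; exists (n, sg).
move=> /choice[p pP]; exists (fun k => sval (G k).2), (fst \o p), (snd \o p).
split=> [|k|k]; [by rewrite G0|exact: (svalP (G k).2)|exact: pP].
Qed.

End Stages.

Section Limit.
Variables (K : numFieldType) (H : completeNormedModType K).
Variables (e : nat -> H) (c : nat -> {scalar H}).
Hypothesis onb : orthonormal_basis e c.
Variables (Q : nat -> {poly K}) (S : nat -> stage K).
Variables (n_ : nat -> nat) (sg : nat -> K).
Hypothesis S0 : S 0 = Stage (fun=> ProfileEntry 1 0 0) 1 2 1.
Hypothesis S_ok : forall k, stage_ok (S k).
Hypothesis S_next : forall k,
  next_block e (Q k) k.+1%:R^-1 (S k) (S k.+1) (n_ k) (sg k).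

Let N k := len (S k).

Definition limit_profile (j : nat) : profile_entry K := profile (S j.+1) j.

Let F := limit_profile.

Lemma len_ltS k : (N k < N k.+1)%N.
Proof. by have /andP[] := next_len (S_next k); exact: ltn_trans. Qed.

Lemma len_le k l : (k <= l)%N -> (N k <= N l)%N.
Proof.
move=> /subnKC <-; elim: (l - k)%N => [|i IH]; first by rewrite addn0.
by rewrite addnS (leq_trans IH) // ltnW // len_ltS.
Qed.

Lemma len_gt k : (k < N k)%N.
Proof.
elim: k => [|k IH]; first by rewrite /N S0.
exact: leq_trans (len_ltS k).
Qed.

Lemma profile_stable k l j : (k <= l)%N -> (j < N k)%N ->
  profile (S l) j = profile (S k) j.
Proof.
move=> /subnKC <- jk; elim: (l - k)%N => [|i IH]; first by rewrite addn0.
rewrite addnS (next_old (S_next _)) //.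
by rewrite (leq_trans jk) // len_le // leq_addr.
Qed.

Lemma profile_limit k j : (j < N k)%N -> profile (S k) j = F j.
Proof.
move=> jk; have [kj|/ltnW jk'] := leqP k j.+1.
  by rewrite /F /limit_profile (profile_stable kj).
by rewrite (profile_stable jk') // (ltn_trans (ltnSn j)) // len_gt.
Qed.

Lemma limit_scale j : scale (F j) != 0.
Proof.
have [_ /(_ j) h _ _ _] := S_ok j.+1.
by have [|] := h _; first exact: ltn_trans (len_gt j.+1).
Qed.

Lemma limit_size j : (size (feedback (F j)) <= j)%N.
Proof.
have [_ /(_ j) h _ _ _] := S_ok j.+1.
by have [|] := h _; first exact: ltn_trans (len_gt j.+1).
Qed.

Lemma limit_error k j : (j.+1 < N k)%N ->
  column_error e (profile (S k)) j = column_error e F j.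
Proof.
move=> jk; apply: (@eq_column_error _ _ e _ _ (N k)) => //.
- by rewrite profile_limit ?limit_size // ltnW.
- by rewrite profile_limit ?limit_size.
- by move=> i; exact: profile_limit.
Qed.

Lemma limit_sqr_error k l m : (m < N k)%N ->
  sqr_error e (profile (S k)) l m = sqr_error e F l m.
Proof.
move=> mk; apply: eq_big_nat => j /andP[_ jm].
by rewrite limit_error // (leq_ltn_trans jm).
Qed.

Lemma sqr_errorD l m p : (l <= m <= p)%N ->
  sqr_error e F l p = sqr_error e F l m + sqr_error e F m p.
Proof. by move=> /andP[lm mp]; rewrite /sqr_error (@big_cat_nat _ _ _ m). Qed.

Lemma sqr_error_ge0 l m : 0 <= sqr_error e F l m.
Proof. by apply: sumr_ge0 => j _; rewrite exprn_ge0. Qed.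

Lemma len_pred k : (N k).-1.+1 = N k.
Proof. by rewrite prednK // (leq_trans _ (len_gt k)). Qed.

Lemma len_pred_le k l : (k <= l)%N -> ((N k).-1 <= (N l).-1)%N.
Proof. by move=> kl; rewrite -ltnS len_pred len_pred len_le. Qed.

(** The errors of a block and the budget it leaves fit in the budget it received,
so by telescoping a budget bounds all later column errors together. *)
Lemma limit_budget k m : sqr_error e F (N k).-1 m <= budget (S k).
Proof.
have main l : sqr_error e F (N k).-1 (N (k + l)).-1 + budget (S (k + l)) <=
    budget (S k).
  elim: l => [|l IH]; first by rewrite addn0 /sqr_error big_geq // add0r.
  apply: le_trans IH; rewrite addnS (@sqr_errorD _ (N (k + l)).-1); last first.
    by rewrite !len_pred_le ?leq_addr.
  rewrite -addrA lerD2l; apply: le_trans (next_budget (S_next (k + l))).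
  by rewrite limit_sqr_error // -/(N _) len_pred.
have b0 l : 0 <= budget (S l) by have [_ _ _ _ /ltW] := S_ok l.
have := main m; have [mN|Nm] := leqP m (N k).-1.
  by move=> _; rewrite /sqr_error big_geq.
apply: le_trans; apply: ler_wpDr => //.
rewrite (@sqr_errorD _ m (N (k + m)).-1) ?lerDl ?sqr_error_ge0 //.
rewrite (ltnW Nm) -ltnS len_pred (leq_trans (len_gt m)) // len_le //.
exact: leq_addl.
Qed.

Lemma rate_le k l : (k <= l)%N -> rate (S l) <= rate (S k).
Proof.
move=> /subnKC <-; elim: (l - k)%N => [|i IH]; first by rewrite addn0.
by rewrite addnS (le_trans _ IH) // (next_rate (S_next _)).
Qed.

Lemma limit_ratio k j : (N k <= j)%N -> `|ratio (F j)| <= rate (S k).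
Proof.
move=> kj.
have main l : (j < N (k + l))%N -> `|ratio (F j)| <= rate (S k).
  elim: l => [|l IH]; first by rewrite addn0 ltnNge kj.
  have [jl _|lj] := ltnP j (N (k + l)); first exact: IH.
  rewrite addnS => jl; rewrite -(profile_limit jl).
  have [jn|nj] := ltnP j (n_ (k + l)).
    rewrite (le_trans (next_ratio_climb (S_next (k + l)) _)) ?rate_le ?leq_addr //.
    by rewrite lj jn.
  rewrite (le_trans (next_ratio_fade (S_next (k + l)) _)) ?rate_le //; last first.
    by rewrite leqW // leq_addr.
  by rewrite nj jl.
by apply: (main j); rewrite (leq_trans (len_gt j)) // len_le // leq_addl.
Qed.

Lemma limit_ratio2 j : `|ratio (F j)| <= 2.
Proof.
have [j0|] := leqP 1 j; first by have := @limit_ratio 0 j; rewrite /N S0; exact.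
case: j => // _; rewrite -(@profile_limit 0) ?len_gt // S0 /= normr0.
by rewrite ler0n.
Qed.

Lemma limit_operator : exists T : {linear H -> H},
  (forall j, T (e j) = column e F j) /\ (forall x, `|T x| <= 3 * `|x|).
Proof.
have vs m : \sum_(0 <= j < m) `|column_error e F j| ^+ 2 <= 1 ^+ 2.
  by have := limit_budget 0 m; rewrite /N S0 expr1n.
have [T [Te TB]] :=
  column_operator onb (ler0n _ 2) ler01 limit_ratio2 vs.
exists T; split=> [j|x]; first by rewrite Te addrC subrK.
by have := TB x; rewrite natr1.
Qed.

Variable T : {linear H -> H}.
Hypothesis Te : forall j, T (e j) = column e F j.
Hypothesis TB : forall x, `|T x| <= 3 * `|x|.

Lemma operator_orbit_vec j : T (orbit_vec e F j) = orbit_vec e F j.+1.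
Proof.
elim/ltn_ind: j => j IH.
rewrite orbit_vecE ?limit_size // linearD linearZ /= Te /column.
rewrite scalerA divff ?limit_scale // scale1r.
have -> : T (orbit_comb e F (feedback (F j))) =
    orbit_comb e F (feedback (F j) * 'X); last by rewrite subrK.
rewrite mulrC -['X]expr1 orbit_combX /orbit_comb linear_sum.
apply: eq_bigr => i _; rewrite linearZ /= IH //.
exact: leq_trans (limit_size j).
Qed.

Lemma orbit_vec0 : orbit_vec e F 0 = e 0.
Proof.
rewrite orbit_vecE ?limit_size // -(@profile_limit 0) ?len_gt // S0 /=.
by rewrite scale1r (linear0 (orbit_comb e F)) addr0.
Qed.

Lemma orbit_vec_iter j : orbit_vec e F j = iter j T (e 0).
Proof.
by elim: j => [|j IH]; rewrite ?orbit_vec0 // -operator_orbit_vec IH.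
Qed.

Lemma orbit_combE p : orbit_comb e F p = poly_op p T (e 0).
Proof. by apply: eq_bigr => i _; rewrite orbit_vec_iter. Qed.

(** Solve [x_j = scale *: e j + orbit_comb feedback] for [e j]. *)
Lemma cyclic_vector j : exists p, e j = poly_op p T (e 0).
Proof.
exists ((scale (F j))^-1 *: ('X^j - feedback (F j))).
rewrite -orbit_combE linearZ /= (linearB (orbit_comb e F)) /=.
rewrite -['X^j]mulr1 orbit_combX size_poly1 big_ord1 coef1 eqxx scale1r addn0.
rewrite orbit_vecE ?limit_size // addrK scalerA mulVf ?limit_scale //.
by rewrite scale1r.
Qed.

(** Cutting the weak link at [n] and dropping all later column errors changes
[T] by at most [sg k] in Hilbert-Schmidt norm.  The result is the direct sum of
the model operator on [n] vectors and a weighted shift. *)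
Lemma cut_operator k : exists S' : {linear H -> H},
  [/\ forall x, `|T x - S' x| <= sg k * `|x|,
      forall j, (j.+1 < n_ k)%N -> S' (e j) = T (e j),
      S' (e (n_ k).-1) =
        (scale (F (n_ k).-1))^-1 *: orbit_comb e F (Q k)
    & forall j, (n_ k <= j)%N -> S' (e j) = ratio (F j) *: e j.+1].
Proof.
have nb := S_next k; set n := n_ k; set q := Q k.
have /andP[Nn nN] : (N k < n < N k.+1)%N by exact: next_len nb.
have n_1 : n.-1.+1 = n by rewrite prednK // (leq_trans _ Nn).
have n1N : (n.-1 < N k.+1)%N by rewrite (leq_ltn_trans (leq_pred n)).
have [F_turn r_turn] := next_turn nb; rewrite !(profile_limit n1N) in F_turn r_turn.
have linkE : turn_link e (profile (S k.+1)) n q = turn_link e F n q.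
  rewrite /turn_link (profile_limit n1N) limit_error ?n_1 //.
  congr (_ - _ *: _).
  apply: (@eq_orbit_comb _ _ _ _ _ _ n); first exact: next_size nb.
  by move=> i ltin; rewrite profile_limit // (ltn_trans ltin).
pose v j := if (j.+1 < n)%N then 0 else
  if (j < n)%N then turn_link e F n q else column_error e F j.
have sg0 : 0 <= sg k by rewrite ltW // (next_sg nb).
have vs m : \sum_(0 <= j < m) `|v j| ^+ 2 <= sg k ^+ 2.
  pose p := maxn m (N k.+1).
  have Np : (N k.+1 <= p)%N by rewrite leq_maxr.
  apply: (@le_trans _ _ (\sum_(0 <= j < p) `|v j| ^+ 2)).
    have mp : (m <= p)%N by rewrite leq_maxl.
    rewrite [leRHS](@big_cat_nat _ _ _ m) //= lerDl.
    by apply: sumr_ge0 => i _; rewrite exprn_ge0.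
  have np : (n <= p)%N by rewrite (leq_trans _ Np) // ltnW.
  rewrite (@big_cat_nat _ _ _ n.-1) //=; last by rewrite (leq_trans (leq_pred n)).
  rewrite big_nat_cond big1 ?add0r => [|j /andP[/andP[_ jn] _]]; last first.
    by rewrite /v -ltnS n_1 in jn *; rewrite jn normr0 expr0n.
  rewrite big_ltn ?n_1 //.
  have -> : v n.-1 = turn_link e F n q by rewrite /v n_1 ltnn leqnn.
  have -> : \sum_(n <= j < p) `|v j| ^+ 2 = sqr_error e F n p.
    apply: eq_big_nat => j /andP[nj _]; rewrite /v !ltnNge nj.
    by rewrite (leq_trans nj).
  have nN1 : (n <= (N k.+1).-1)%N by rewrite -ltnS len_pred.
  rewrite (@sqr_errorD n (N k.+1).-1); last first.
    by rewrite nN1 (leq_trans (leq_pred _)).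
  apply: le_trans (next_link nb); rewrite linkE limit_sqr_error ?len_pred // addrA.
  by rewrite lerD2l limit_budget.
have [D [De DB]] := column_operator onb (lexx 0)  sg0 (w := fun=> 0)
  (fun j => eq_ind_r (fun z => z <= 0) (lexx 0) (normr0 K)) vs.
exists (T \- D); split => [x|j jn||j nj] /=.
- by rewrite opprB addrC subrK; have := DB x; rewrite add0r.
- by rewrite De scale0r add0r /v jn subr0.
- rewrite De scale0r add0r /v n_1 ltnn leqnn Te /turn_link /column_error r_turn.
  by rewrite scale0r subr0 opprB addrC subrK.
- rewrite De scale0r add0r /v !ltnNge nj (leq_trans nj) //= Te /column_error.
  by rewrite opprB addrC subrK.
Qed.

(** On the first [n] basis vectors the cut operator is multiplication by [X] on
[K[X]/(X^n - q)]: the equality holds at the cyclic vector [e 0], hence on its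
orbit, which spans these vectors. *)
Lemma cut_operator_power k (S' : {linear H -> H}) :
  (forall j, (j.+1 < n_ k)%N -> S' (e j) = T (e j)) ->
  S' (e (n_ k).-1) = (scale (F (n_ k).-1))^-1 *: orbit_comb e F (Q k) ->
  forall j, (j < n_ k)%N -> iter (n_ k) S' (e j) = poly_op (Q k) S' (e j).
Proof.
have nb := S_next k; set n := n_ k; set q := Q k => S'T S'n.
have /andP[Nn nN] : (N k < n < N k.+1)%N by exact: next_len nb.
have n_1 : n.-1.+1 = n by rewrite prednK // (leq_trans _ Nn).
have n1N : (n.-1 < N k.+1)%N by rewrite (leq_ltn_trans (leq_pred n)).
have [F_turn _] := next_turn nb; rewrite (profile_limit n1N) in F_turn.
have S'vec i : (i.+1 < n)%N -> S' (orbit_vec e F i) = orbit_vec e F i.+1.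
  rewrite -operator_orbit_vec; elim/ltn_ind: i => i IH ltin.
  rewrite orbit_vecE ?limit_size // (orbit_comb_widen _ _ (limit_size i)).
  rewrite !linearD !linearZ /= S'T //; congr (_ + _).
  rewrite !linear_sum; apply: eq_bigr => l _; rewrite !linearZ /= IH //.
  exact: leq_ltn_trans (ltn_ord l) (ltnW ltin).
have S'iter i : (i < n)%N -> orbit_vec e F i = iter i S' (e 0).
  elim: i => [|i IH] ltin; first by rewrite orbit_vec0.
  by rewrite iterS -IH ?S'vec // ltnW.
have S'q : iter n S' (e 0) = poly_op q S' (e 0).
  have -> : iter n S' (e 0) = S' (orbit_vec e F n.-1).
    by rewrite S'iter -?iterS n_1.
  rewrite orbit_vecE ?limit_size // F_turn (linear0 (orbit_comb e F)) addr0.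
  rewrite linearZ /= S'n scalerA divff ?limit_scale // scale1r.
  apply: eq_bigr => i _; rewrite S'iter // (leq_trans (ltn_ord i)) //.
  exact: next_size nb.
have vecq i : (i < n)%N ->
    iter n S' (orbit_vec e F i) = poly_op q S' (orbit_vec e F i).
  move=> ltin; rewrite S'iter //; elim: (i) => [|l IH] //=.
  by rewrite -iterSr iterS IH poly_opS.
move=> j jn.
pose Z := [set z : H | iter n S' z = poly_op q S' z].
have ZP a x y : Z x -> Z y -> Z (a *: x + y).
  by rewrite /Z /= => Zx Zy; rewrite iter_linear poly_op_linear Zx Zy.
have Z0 : Z 0.
  have h := vecq 0%N (leq_trans (ltn0Sn _) Nn).
  have := ZP (-1) _ _ h h; by rewrite scaleN1r addNr.
have Zsum m (a : nat -> K) : (m <= n)%N -> Z (\sum_(i < m) a i *: orbit_vec e F i).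
  elim: m => [|m IH] mn; first by rewrite big_ord0.
  by rewrite big_ord_recr /= addrC; apply: (ZP); [exact: vecq|exact/IH/ltnW].
have eE : e j = (scale (F j))^-1 *: (orbit_vec e F j -
    \sum_(i < j) (feedback (F j))`_i *: orbit_vec e F i) + 0.
  rewrite addr0 orbit_vecE ?limit_size // (orbit_comb_widen _ _ (limit_size j)).
  by rewrite addrK scalerA mulVf ?limit_scale // scale1r.
rewrite -[_ = _]/(Z (e j)) eE; apply: (ZP) => //.
rewrite addrC -scaleN1r; apply: (ZP); last exact: vecq.
exact/Zsum/ltnW.
Qed.

Lemma power_near_polynomial k x : exists2 n, (k < n)%N &
  `|iter n T x - poly_op (Q k) T x| <= k.+1%:R^-1 * `|x| +
    (rate_bound (Q k) * 2 + poly_norm (Q k) 4) * `|x - trunc e c n x|.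
Proof.
have nb := S_next k; set q := Q k; set n := n_ k.
have /andP[Nn nN] : (N k < n < N k.+1)%N by exact: next_len nb.
exists n; first exact: ltn_trans (len_gt k) Nn.
have [S' [TS' S'T S'n S'e]] := cut_operator k.
have sg0 : 0 <= sg k by rewrite ltW // (next_sg nb).
have sg1 : sg k <= 1.
  have n1 : 1 <= n%:R * 4 ^+ n :> K.
    by rewrite -natrX -natrM ler1n muln_gt0 expn_gt0 (leq_trans _ Nn).
  have := next_precision nb; rewrite -/n -/q => h.
  apply: le_trans (le_trans h _); last by rewrite invf_le1 ?ltr0n // ler1n.
  by rewrite ler_peMl // (le_trans n1) // lerDl poly_sensitivity_ge0.
have S'B z : `|S' z| <= 4 * `|z|.
  rewrite -(subrK (T z) (S' z)) (le_trans (ler_normD _ _)) // distrC.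
  have -> : 4 = 1 + 3 :> K by rewrite nat1r.
  by rewrite mulrDl lerD // (le_trans (TS' z)) // ler_wpM2r.
have TB4 z : `|T z| <= 4 * `|z|.
  by rewrite (le_trans (TB z)) // ler_wpM2r // ler_nat.
have om0 : 0 <= rate (S k.+1).
  by have [_ _ _ + _] := S_ok k.+1; move=> /ltW; apply: le_trans.
have S'shift j : (n <= j)%N -> S' (e j) = ratio (F j) *: e j.+1 /\
    `|ratio (F j)| <= rate (S k.+1).
  move=> nj; split; first exact: S'e.
  have [jN|Nj] := ltnP j (N k.+1); last exact: limit_ratio.
  by rewrite -(profile_limit jN) (next_ratio_fade nb) // nj.
have four1 : 1 <= 4 :> K by rewrite ler1n.
have := iter_near_poly onb x om0 sg0 four1 TB4 S'B TS' S'shift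
  (cut_operator_power S'T S'n).
move=> /le_trans; apply; apply: lerD; rewrite ler_wpM2r //.
  exact: next_precision nb.
by rewrite lerD2r; exact: next_power nb.
Qed.

End Limit.

Theorem read_type_operator (K : numFieldType) (H : completeNormedModType K)
    (e : nat -> H) (c : nat -> {scalar H}) (Q : nat -> {poly K}) :
  Num.archimedean_axiom K -> orthonormal_basis e c ->
  exists T : {linear H -> H},
  [/\ forall x, `|T x| <= 3 * `|x|,
      forall j, exists p, e j = poly_op p T (e 0)
    & forall k x, exists2 n, (k < n)%N &
        `|iter n T x - poly_op (Q k) T x| <= k.+1%:R^-1 * `|x| +
          (rate_bound (Q k) * 2 + poly_norm (Q k) 4) * `|x - trunc e c n x|].
Proof.
move=> archK onb; have [S [n_ [sg [S0 S_ok S_next]]]] := stages archK onb Q.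
have [T [Te TB]] := limit_operator onb S0 S_ok S_next.
exists T; split => //; first exact: (cyclic_vector S0 S_ok S_next Te).
exact: (power_near_polynomial onb S0 S_ok S_next Te TB).
Qed.

(** * Gram-Schmidt *)

Lemma dense_near (K : numFieldType) (H : normedModType K) (D : set H) x eps :
  dense D -> 0 < eps -> exists2 y, D y & `|x - y| < eps.
Proof.
move=> denseD eps0.
have [||y [/interior_subset xy Dy]] := denseD ((ball x eps)°).
- by exists x; apply: nbhsx_ballx.
- exact: open_interior.
- by exists y => //; move: xy; rewrite -ball_normE.
Qed.

Lemma near_dense (K : numFieldType) (H : normedModType K) (D : set H) :
  (forall x eps, 0 < eps -> exists2 y, D y & `|x - y| < eps) -> dense D.
Proof.
move=> nearD O [x Ox] oO.
have /nbhs_ballP[eps /= eps0 epsO] : nbhs x O by exact: open_nbhs_nbhs.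
have [y Dy xy] := nearD x _ eps0; exists y; split=> //.
by apply: epsO; rewrite -ball_normE.
Qed.

Section GramSchmidt.
Variables (K : numFieldType) (H : normedModType K).
Variables (theta : {rmorphism K -> K}) (dot : {dot H for theta}).
Hypothesis theta_sqr : forall a, a * theta a = `|a| ^+ 2.
Hypothesis norm_dot : norm_from_dot dot.
Hypothesis inf_dim : infinite_dimensional H.
Variable d : nat -> H.
Hypothesis d_dense : forall x eps, 0 < eps -> exists k, `|x - d k| < eps.

Lemma dotBl x y z : dot (x - y) z = dot x z - dot y z.
Proof. exact: linearBl. Qed.

Lemma dotZl a x y : dot (a *: x) y = a * dot x y.
Proof. exact: linearZl_LR. Qed.

Lemma dotZr a x y : dot x (a *: y) = theta a * dot x y.
Proof. exact: linearZr_LR. Qed.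

Lemma dot_suml l m (f : nat -> H) y :
  dot (\sum_(l <= i < m) f i) y = \sum_(l <= i < m) dot (f i) y.
Proof. exact: linear_sumlz. Qed.

Lemma dot_sumr l m x (f : nat -> H) :
  dot x (\sum_(l <= i < m) f i) = \sum_(l <= i < m) dot x (f i).
Proof. exact: linear_sumr. Qed.

Lemma dotC x y : dot x y = theta (dot y x).
Proof. by have := hermC dot x y; rewrite expr0 mul1r. Qed.

Definition residual (s : seq H) (x : H) : H :=
  x - \sum_(i < size s) dot x s`_i *: s`_i.

Definition next_vector (s : seq H) : H :=
  if pselect (exists k, residual s (d k) != 0) is left h then
    let r := residual s (d (ex_minn h)) in `|r|^-1 *: r
  else 0.

Fixpoint gram_schmidt_seq n : seq H :=
  if n is n'.+1 then
    rcons (gram_schmidt_seq n') (next_vector (gram_schmidt_seq n'))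
  else [::].

Definition gram_schmidt n := next_vector (gram_schmidt_seq n).

Local Notation e := gram_schmidt.

Lemma gram_schmidt_seqE n : gram_schmidt_seq n = mkseq e n.
Proof. by elim: n => // n IH; rewrite /= mkseqS -IH. Qed.

Definition rest n (x : H) : H := x - \sum_(0 <= i < n) dot x (e i) *: e i.

Lemma residualE n x : residual (gram_schmidt_seq n) x = rest n x.
Proof.
rewrite /residual gram_schmidt_seqE size_mkseq /rest big_mkord.
by congr (_ - _); apply: eq_bigr => i _; rewrite nth_mkseq.
Qed.

Definition orthonormal_upto n := forall i j, (i < n)%N -> (j < n)%N ->
  dot (e i) (e j) = (i == j)%:R.

Lemma dot_comb n l m (a : nat -> K) j : orthonormal_upto n ->
  (m <= n)%N -> (j < n)%N ->
  dot (\sum_(l <= i < m) a i *: e i) (e j) = if (l <= j < m)%N then a j else 0.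
Proof.
move=> on mn jn; rewrite dot_suml.
have -> : \sum_(l <= i < m) dot (a i *: e i) (e j) =
    \sum_(l <= i < m) a i * (i == j)%:R.
  by apply: eq_big_nat => i /andP[_ im]; rewrite dotZl on // (leq_trans im).
case: ifP => [/andP[lj jm]|ljm].
  rewrite (@big_cat_nat _ _ _ j) ?(ltnW jm) //= [X in _ + X]big_ltn //=.
  rewrite eqxx mulr1 big_nat_cond big1 ?add0r => [|i /andP[/andP[_ ij] _]]; last first.
    by rewrite ltn_eqF ?mulr0.
  rewrite big_nat_cond big1 ?addr0 // => i /andP[/andP[ji _] _].
  by rewrite gtn_eqF ?mulr0.
rewrite big_nat_cond big1 // => i /andP[lim _].
by case: eqP lim ljm => [->|]; rewrite ?mulr0 // => ->.
Qed.

Lemma dot_rest n x j : orthonormal_upto n -> (j < n)%N -> dot (rest n x) (e j) = 0.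
Proof. by move=> on jn; rewrite dotBl (dot_comb _ _ on) // jn subrr. Qed.

Lemma sqr_norm_comb_dot n l m (a : nat -> K) : orthonormal_upto n -> (m <= n)%N ->
  `|\sum_(l <= i < m) a i *: e i| ^+ 2 = \sum_(l <= i < m) `|a i| ^+ 2.
Proof.
move=> on mn; rewrite norm_dot dot_sumr; apply: eq_big_nat => j /andP[lj jm].
rewrite dotZr (dot_comb _ _ on mn (leq_trans jm mn)) lj jm.
by rewrite mulrC theta_sqr.
Qed.

Lemma sqr_norm_rest n x : orthonormal_upto n ->
  `|x| ^+ 2 = `|rest n x| ^+ 2 + \sum_(0 <= i < n) `|dot x (e i)| ^+ 2.
Proof.
move=> on; rewrite -(sqr_norm_comb_dot _ _ on) //.
set y := \sum_(_ <= _ < _) _; have xE : x = rest n x + y by rewrite subrK.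
rewrite {1}xE !norm_dot; apply: hnormDd; rewrite -[LHS]/(dot _ _) /y.
rewrite dot_sumr big_nat_cond big1 // => i /andP[/andP[_ ltin] _].
by rewrite dotZr dot_rest // mulr0.
Qed.

Lemma norm_rest n x : orthonormal_upto n -> `|rest n x| <= `|x|.
Proof.
move=> on; rewrite -ler_sqr ?nnegrE // [leRHS](sqr_norm_rest x on) lerDl.
by rewrite sumr_ge0 // => i _; rewrite exprn_ge0.
Qed.

Lemma restB n x y : rest n (x - y) = rest n x - rest n y.
Proof.
rewrite /rest; under eq_bigr do rewrite dotBl scalerBl.
by rewrite sumrB [- (_ - _)]opprD addrACA -opprD.
Qed.

(** Otherwise [rest n], being contractive and zero on a dense set, vanishes
everywhere, and [n] vectors span the space. *)
Lemma exists_rest n : orthonormal_upto n -> exists k, rest n (d k) != 0.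
Proof.
move=> on; apply: contrapT => /forallNP d0.
have rest0 x : rest n x = 0.
  apply/eqP; rewrite -normr_le0; apply/ler_addgt0Pr => eps eps0.
  have [k xk] := d_dense x eps0; rewrite add0r.
  have /negP/negPn/eqP dk := d0 k.
  rewrite -[rest n x]subr0 -dk -restB (le_trans _ (ltW xk)) //.
  exact: norm_rest.
have [x /(_ (fun i => dot x (e i)))] := inf_dim (fun i : 'I_n => e i).
apply; apply/eqP; rewrite -subr_eq0; have := rest0 x.
by rewrite /rest big_mkord => ->.
Qed.

Lemma gram_schmidtP n : orthonormal_upto n ->
  exists k, [/\ rest n (d k) != 0,
    forall l, rest n (d l) != 0 -> (k <= l)%N &
    e n = `|rest n (d k)|^-1 *: rest n (d k)].
Proof.
move=> on; rewrite /e /next_vector; case: pselect => [h|]; last first.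
  by case; have [k kP] := exists_rest on; exists k; rewrite residualE.
case: ex_minnP => k; rewrite residualE => dk min_k; exists k; split=> // l dl.
by apply: min_k; rewrite residualE.
Qed.

Lemma gram_schmidt_orthonormal n : orthonormal_upto n.
Proof.
elim: n => // n on; have [k [dk _ en]] := gram_schmidtP on.
have dotn j : (j < n)%N -> dot (e n) (e j) = 0.
  by move=> jn; rewrite en dotZl dot_rest // mulr0.
have dotnn : dot (e n) (e n) = 1.
  rewrite -norm_dot en normrZ normfV normr_id mulVf ?expr1n //.
  by rewrite normr_eq0.
move=> i j; rewrite (ltnS i) (ltnS j) (leq_eqVlt i) (leq_eqVlt j).
move=> /orP[/eqP ->|ltin] /orP[/eqP ->|jn].
- by rewrite eqxx.
- by rewrite dotn // gtn_eqF.
- by rewrite dotC dotn // rmorph0 ltn_eqF.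
- exact: on.
Qed.

Lemma restS n x : rest n.+1 x = rest n x - dot (rest n x) (e n) *: e n.
Proof.
have on := @gram_schmidt_orthonormal n.+1.
rewrite {3}/rest dotBl (dot_comb _ _ on) // ltnn andbF subr0.
by rewrite /rest big_nat_recr //= opprD addrA.
Qed.

Lemma rest0S n x : rest n x = 0 -> rest n.+1 x = 0.
Proof.
move=> x0; rewrite restS x0 sub0r.
have -> : dot 0 (e n) = 0 by have := dotZl 0 0 (e n); rewrite scale0r mul0r.
by rewrite scale0r oppr0.
Qed.

(** The index chosen at step [n] is at least [n] by induction, so [d n] either
was in the span already or is the vector chosen at that step. *)
Lemma rest_dense n k : (k < n)%N -> rest n (d k) = 0.
Proof.
elim: n k => // n IH k; rewrite ltnS leq_eqVlt => /orP[/eqP -> {k}|kn]; last first.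
  exact/rest0S/IH.
have [k [dk min_k en]] := gram_schmidtP (@gram_schmidt_orthonormal n).
have [/eqP/rest0S//|dn] := boolP (rest n (d n) == 0).
have nk : k = n.
  apply/eqP; rewrite eqn_leq min_k //= leqNgt; apply/negP => /IH.
  by move/eqP; apply/negP.
rewrite {}nk in en dk *; rewrite restS en dotZr -norm_dot scalerA.
set r := rest n (d n) in dk *.
have r0 : `|r| != 0 by rewrite normr_eq0.
have -> : theta `|r|^-1 = `|r|^-1.
  apply: (mulfI (x := `|r|^-1)); first by rewrite invr_eq0.
  by rewrite theta_sqr normfV normr_id.
have -> : `|r|^-1 * `|r| ^+ 2 * `|r|^-1 = 1 by field.
by rewrite scale1r subrr.
Qed.

Lemma coord_is_scalar i : scalar (fun x => dot x (e i)).
Proof. by move=> a x y; exact: linearPl. Qed.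

Lemma gram_schmidt_basis : exists (b : nat -> H) (c : nat -> {scalar H}),
  orthonormal_basis b c.
Proof.
pose c i : {scalar H} := HB.pack (fun x => dot x (e i))
  (GRing.isLinear.Build K H K _ _ (coord_is_scalar i)).
have on := @gram_schmidt_orthonormal.
exists e, c; split => [i j|l m a|m x|x eps eps0].
- rewrite /= (on (maxn i j).+1) ?ltnS ?leq_maxl ?leq_maxr //.
  by rewrite eq_sym.
- exact: sqr_norm_comb_dot (on m) (leqnn m).
- by rewrite [leRHS](sqr_norm_rest x (on m)) lerDr exprn_ge0.
- have [k xk] := d_dense x eps0; exists k.+1 => m km.
  apply: le_lt_trans xk; rewrite -/(rest m x) -[rest m x]subr0 -(rest_dense km).
  by rewrite -restB norm_rest.
Qed.

End GramSchmidt.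

(** The enumeration takes the value [0] outside the image of the countable
dense set. *)
Lemma separable_enum (K : numFieldType) (H : normedModType K) :
  separable H -> exists d : nat -> H,
    forall x eps, 0 < eps -> exists k, `|x - d k| < eps.
Proof.
move=> [D /countable_injP[f f_inj] denseD].
exists (fun k => xget 0 [set x | D x /\ f x = k]) => x eps eps0.
have [y Dy xy] := dense_near x denseD eps0; exists (f y).
case: xgetP => [z _ [Dz fz]|/(_ y)]; last by case.
by rewrite (f_inj z y) ?inE.
Qed.

Lemma hilbert_basis (K : numFieldType) (H : normedModType K)
    (theta : {rmorphism K -> K}) (dot : {dot H for theta}) :
  (forall a, a * theta a = `|a| ^+ 2) ->
  norm_from_dot dot -> separable H -> infinite_dimensional H ->
  exists (b : nat -> H) (c : nat -> {scalar H}), orthonormal_basis b c.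
Proof.
move=> thetaP normP /separable_enum[d dP] infP.
exact: (gram_schmidt_basis thetaP normP infP dP).
Qed.

(** * Orbit closures *)

Lemma closure_normP (K : numFieldType) (H : normedModType K) (A : set H) x :
  closure A x <-> forall eps, 0 < eps -> exists2 y, A y & `|x - y| < eps.
Proof.
split=> [clA eps eps0|nearA B /nbhs_ballP[eps /= eps0 epsB]].
  have [y [Ay xy]] := clA _ (nbhsx_ballx x eps eps0).
  by exists y => //; move: xy; rewrite -ball_normE.
have [y Ay xy] := nearA _ eps0; exists y; split=> //.
by apply: epsB; rewrite -ball_normE.
Qed.

Lemma linear_subspace_closure (K : numFieldType) (H : normedModType K)
    (A : set H) :
  A 0 -> (forall a x y, A x -> A y -> A (a *: x + y)) ->
  linear_subspace (closure A).
Proof.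
move=> A0 AP; split; first by rewrite in_setE; exact: subset_closure.
move=> a x y; rewrite !in_setE => /closure_normP Ax /closure_normP Ay.
apply/closure_normP => eps eps0.
have a1 : 0 < `|a| + 1 by rewrite ltr_wpDl.
have eps2 : 0 < eps / 2 by rewrite divr_gt0.
have [u Au xu] := Ax _ (divr_gt0 eps2 a1); have [v Av yv] := Ay _ eps2.
exists (a *: u + v); first exact: AP.
rewrite opprD addrACA -scalerBr (le_lt_trans (ler_normD _ _)) // normrZ.
have -> : eps = eps / 2 + eps / 2 by field.
apply: ler_ltD => //.
apply: (@le_trans _ _ (`|a| * (eps / 2 / (`|a| + 1)))).
  by rewrite ler_wpM2l // ltW.
rewrite mulrCA ler_piMr ?(ltW eps2) // ler_pdivrMr // mul1r lerDl.
exact: ler01.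
Qed.

Section Polynomials.
Variables (K : numFieldType) (H : normedModType K) (T : {linear H -> H}).
Implicit Types (p q : {poly K}) (x : H).

Lemma poly_op_widen p n x : (size p <= n)%N ->
  poly_op p T x = \sum_(i < n) p`_i *: iter i T x.
Proof.
move=> pn; rewrite /poly_op (big_ord_widen n (fun i => p`_i *: iter i T x)) //.
rewrite big_mkcond /=; apply: eq_bigr => i _.
by case: ltnP => // pi; rewrite nth_default // scale0r.
Qed.

Lemma poly_opP a p q x :
  poly_op (a *: p + q) T x = a *: poly_op p T x + poly_op q T x.
Proof.
pose n := maxn (size p) (size q).
have apq : (size (a *: p + q)%R <= n)%N.
  rewrite (leq_trans (size_polyD _ _)) // geq_max leq_maxr andbT.
  by rewrite (leq_trans (size_scale_leq _ _)) // leq_maxl.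
rewrite !(@poly_op_widen _ n) ?leq_maxl ?leq_maxr //.
rewrite scaler_sumr -big_split /=; apply: eq_bigr => i _.
by rewrite coefD coefZ scalerDl scalerA.
Qed.

Lemma poly_op0 x : poly_op 0 T x = 0.
Proof. by rewrite /poly_op size_poly0 big_ord0. Qed.

Lemma poly_opXn n x : poly_op 'X^n T x = iter n T x.
Proof.
rewrite /poly_op size_polyXn big_ord_recr /= coefXn eqxx scale1r.
by rewrite big1 ?add0r // => i _; rewrite coefXn ltn_eqF // scale0r.
Qed.

Lemma Orb_sub_poly_Orb x : Orb x T `<=` poly_Orb x T.
Proof. by move=> _ [n _ <-]; exists 'X^n => //; rewrite poly_opXn. Qed.

Lemma poly_Orb_subspace x : poly_Orb x T 0 /\
  forall a y z, poly_Orb x T y -> poly_Orb x T z -> poly_Orb x T (a *: y + z).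
Proof.
split; first by exists 0 => //; rewrite poly_op0.
move=> a _ _ [p _ <-] [q _ <-]; exists (a *: p + q) => //.
exact: poly_opP.
Qed.

Lemma orbit_closure_subspace :
  (forall x p eps, 0 < eps ->
    exists n, `|poly_op p T x - iter n T x| < eps) ->
  forall x, linear_subspace (closure (Orb x T)) /\
    closure (Orb x T) = closure (poly_Orb x T).
Proof.
move=> near x.
have clE : closure (Orb x T) = closure (poly_Orb x T).
  apply/seteqP; split; first exact/closureS/Orb_sub_poly_Orb.
  move=> y /closure_normP yp; apply/closure_normP => eps eps0.
  have eps2 : 0 < eps / 2 by rewrite divr_gt0.
  have [_ [p _ <-] yp2] := yp _ eps2; have [n pn] := near x p _ eps2.
  exists (iter n T x); first by exists n.
  rewrite -(subrK (poly_op p T x) y) -addrA (le_lt_trans (ler_normD _ _)) //.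
  have -> : eps = eps / 2 + eps / 2 by field.
  exact: ltrD.
split=> //; rewrite clE; have [P0 PP] := poly_Orb_subspace x.
exact: linear_subspace_closure.
Qed.

End Polynomials.

(** The number [k] codes a list of naturals.  Its head is ignored, which makes
every polynomial with coefficients in [D] occur for arbitrarily large [k]. *)
Definition recurrent_poly (K : numFieldType) (D : nat -> K) (k : nat) : {poly K} :=
  Poly (map D (behead (CodeSeq.decode k))).

Lemma recurrent_polyP (K : numFieldType) (D : nat -> K) (l : seq nat) k0 :
  exists2 k, (k0 < k)%N & recurrent_poly D k = Poly (map D l).
Proof.
exists (CodeSeq.code (k0 :: l)); last by rewrite /recurrent_poly CodeSeq.codeK.
by have := CodeSeq.ltn_code (k0 :: l) => /= /andP[].
Qed.

(** A polynomial [p] is first replaced by one of the dense family with the same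
bound on the degree; the error is controlled by the norms of the powers of [T]
below that bound.  Vectors near [p(T)x] in the orbit of [x] then come from
[read_type_operator] with [k] large. *)
Lemma hilbert_read_operator (K : numFieldType) (H : completeNormedModType K)
    (D : nat -> K) (e : nat -> H) (c : nat -> {scalar H}) :
  Num.archimedean_axiom K ->
  (forall a eps, 0 < eps -> exists k, `|a - D k| < eps) ->
  orthonormal_basis e c ->
  exists T : {linear H -> H},
    [/\ bounded_operator T, hypercyclic T
      & forall x : H, linear_subspace (closure (Orb x T)) /\
          closure (Orb x T) = closure (poly_Orb x T)].
Proof.
move=> archK denseD onb.
have [T [TB cyc apx]] := read_type_operator (recurrent_poly D) archK onb.
have near x p eps : 0 < eps -> exists n, `|poly_op p T x - iter n T x| < eps.
  move=> eps0; have eps3 : 0 < eps / 3 by rewrite divr_gt0.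
  pose B := (\sum_(i < size p) 3 ^+ i) * `|x| + 1.
  have B0 : 0 < B.
    rewrite ltr_wpDl // mulr_ge0 // sumr_ge0 // => i _; exact: exprn_ge0.
  have /choice[kap kapP] := fun i => denseD p`_i _ (divr_gt0 eps3 B0).
  pose l := mkseq kap (size p); pose q := Poly (map D l).
  have sq : (size q <= size p)%N.
    by rewrite (leq_trans (size_Poly _)) // size_map size_mkseq.
  have pq : `|poly_op p T x - poly_op q T x| < eps / 3.
    rewrite (poly_op_widen _ _ sq) /poly_op -sumrB.
    rewrite (le_lt_trans (ler_norm_sum _ _ _)) //.
    apply: (@le_lt_trans _ _ (eps / 3 / B * (\sum_(i < size p) 3 ^+ i) * `|x|)).
      rewrite mulr_sumr mulr_suml; apply: ler_sum => i _.
      rewrite -scalerBl normrZ -mulrA ler_pM //; last first.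
        by apply: norm_iter.
      rewrite /q coef_Poly (nth_map 0%N) ?size_mkseq // nth_mkseq //.
      exact/ltW/kapP.
    by rewrite -mulrA -[ltRHS](divfK (lt0r_neq0 B0)) ltr_pM2l ?divr_gt0 // /B ltrDl.
  pose C := rate_bound q * 2 + poly_norm q 4.
  have C0 : 0 <= C.
    rewrite addr_ge0 ?poly_norm_ge0 // mulr_ge0 // addr_ge0 // mulr_ge0 //.
    exact: poly_norm_ge0.
  have C1 : 0 < C + 1 by rewrite ltr_wpDl.
  have [m0 m0P] := expansion onb x (divr_gt0 eps3 C1).
  have [k1 k1P] := natr_ge archK (divr_ge0 (normr_ge0 x) (ltW eps3)).
  have [k kk kq] := recurrent_polyP D l (m0 + k1)%N.
  have [n kn] := apx k x; rewrite kq -/q -/C => apn; exists n.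
  rewrite -(subrK (poly_op q T x) (poly_op p T x)) -addrA.
  rewrite (le_lt_trans (ler_normD _ _)) //.
  have -> : eps = eps / 3 + (eps / 3 + eps / 3) by field.
  apply: ltrD => //; rewrite distrC (le_lt_trans apn) //.
  apply: ler_ltD.
    rewrite mulrC ler_pdivrMr ?ltr0n // mulrC -ler_pdivrMr //.
    rewrite (le_trans k1P) // ler_nat (leq_trans (leq_addl m0 _)) // ltnW //.
    exact: leq_trans kk _.
  apply: (@le_lt_trans _ _ (C * (eps / 3 / (C + 1)))).
    rewrite ler_wpM2l // ltW // m0P // ltnW // (ltn_trans _ kn) //.
    exact: leq_ltn_trans (leq_addr _ _) kk.
  by rewrite mulrCA -[ltRHS]mulr1 ltr_pM2l // ltr_pdivrMr // mul1r ltrDl.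
exists T; split; first by exists 3.
- exists (e 0); apply: near_dense => x eps eps0.
  have eps2 : 0 < eps / 2 by rewrite divr_gt0.
  have [m /(_ m (leqnn m)) xm] := expansion onb x eps2.
  have [P0 PP] := poly_Orb_subspace T (e 0).
  have [p pE] : poly_Orb (e 0) T (trunc e c m x).
    rewrite /trunc; elim: m {xm} => [|m IH]; first by rewrite big_geq.
    rewrite big_nat_recr //= addrC; apply: (PP) => //.
    by have [q ->] := cyc m; exists q.
  move=> pE2; have [n pn] := near (e 0) p _ eps2.
  exists (iter n T (e 0)); first by exists n.
  rewrite -(subrK (poly_op p T (e 0)) x) -addrA (le_lt_trans (ler_normD _ _)) //.
  have -> : eps = eps / 2 + eps / 2 by field.
  by apply: ltrD => //; rewrite pE2.
- exact: orbit_closure_subspace.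
Qed.

Lemma real_archimedean (R : realType) : Num.archimedean_axiom R.
Proof. by move=> x; exists (Num.Def.archi_bound `|x|); exact: archi_boundP. Qed.

Lemma complex_archimedean (R : realType) : Num.archimedean_axiom R[i].
Proof.
move=> x.
have [n nP] :=
  real_archimedean (Num.sqrt (complex.Re x ^+ 2 + complex.Im x ^+ 2)).
exists n; case: x nP => a b /= nP.
rewrite normc_def /= -(rmorph_nat (real_complex R)) ltcR.
by rewrite (le_lt_trans _ nP) // ler_norm.
Qed.

Lemma real_dense_seq (R : realType) : exists D : nat -> R,
  forall a eps, 0 < eps -> exists k, `|a - D k| < eps.
Proof.
exists (fun k => if @unpickle rat k is Some r then ratr r else 0) => a eps eps0.
have h : a - eps < a + eps by rewrite ltrD2l gtrN.
have [r] := rat_in_itvoo h; rewrite in_itv /= => ar.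
by exists (pickle r); rewrite pickleK distrC ltr_distl.
Qed.

Lemma complex_dense_seq (R : realType) : exists D : nat -> R[i],
  forall a eps, 0 < eps -> exists k, `|a - D k| < eps.
Proof.
have [D DP] := real_dense_seq R.
exists (fun k => if @unpickle (nat * nat)%type k is Some (i, j)
  then (D i +i* D j)%C else 0) => -[a b] [x y].
rewrite ltcE /= => /andP[/eqP -> {y} x0].
have x2 : 0 < x / 2 by rewrite divr_gt0.
have [i ai] := DP a _ x2; have [j bj] := DP b _ x2.
exists (pickle (i, j)); rewrite pickleK normc_def ltcR /=.
have sq u : `|u| < x / 2 -> u ^+ 2 < (x / 2) ^+ 2.
  move=> ux; rewrite -(real_normK (num_real u)) ltr_pXn2r ?nnegrE //.
  exact: ltW.
rewrite -[ltRHS](gtr0_norm x0) -sqrtr_sqr ltr_sqrt ?exprn_gt0 //.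
apply: lt_le_trans (ltrD (sq _ ai) (sq _ bj)) _.
have -> : (x / 2) ^+ 2 + (x / 2) ^+ 2 = x ^+ 2 / 2 by field.
by rewrite ler_pdivrMr // ler_peMr ?exprn_ge0 ?(ltW x0) // ler1n.
Qed.

Theorem theorem1p1 (R : realType) :
  (forall (H : completeNormedModType R) (dot : {dot H for @idfun R}),
     norm_from_dot dot -> separable H -> infinite_dimensional H ->
     exists T : {linear H -> H},
       [/\ bounded_operator T,
           hypercyclic T
         & forall x : H,
             linear_subspace (closure (Orb x T)) /\
             closure (Orb x T) = closure (poly_Orb x T)])
  /\
  (forall (H : completeNormedModType R[i])
          (dot : {dot H for @Num.conj R[i]}),
     norm_from_dot dot -> separable H -> infinite_dimensional H ->
     exists T : {linear H -> H},
       [/\ bounded_operator T,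
           hypercyclic T
         & forall x : H,
             linear_subspace (closure (Orb x T)) /\
             closure (Orb x T) = closure (poly_Orb x T)]).
Proof.
split=> H dot normH sepH infH.
  have [e [c onb]] := @hilbert_basis R H idfun dot
    (fun a => esym (real_normK (num_real a))) normH sepH infH.
  have [D denseD] := real_dense_seq R.
  exact: hilbert_read_operator (@real_archimedean R) denseD onb.
have [e [c onb]] := @hilbert_basis R[i] H Num.conj dot
  (fun a => esym (normCK a)) normH sepH infH.
have [D denseD] := complex_dense_seq R.
exact: hilbert_read_operator (@complex_archimedean R) denseD onb.
Qed.
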